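(* Let $S$ be a finite regular monoid and $k$ a field such that the characteristic of $k$ does not divide the order of any maximal subgroup of $S$. Then $kS$ is directed if and only if, for each $\mathscr J$-class $J_i$ of $S$, the sandwich matrix $C_i$ of $J_i$ is left invertible over $kG_i$. In this case, the global dimension of $kS$ is bounded by $m-1$, where $m$ is the length of the longest chain of non-zero $\mathscr J$-classes of $S$.
   Context: Modules are finitely generated right modules. A monoid $S$ is regular if for every $s\in S$ there is $t\in S$ with $sts=s$. Green's preorders: $s\le_{\mathscr J}t$ iff $SsS\subseteq StS$; $s\le_{\mathscr R}t$ iff $sS\subseteq tS$; $s\le_{\mathscr L}t$ iff $Ss\subseteq St$; $\mathscr J,\mathscr R,\mathscr L$ are the associated equivalence relations, and $\le_{\mathscr J}$ induces a partial order on $\mathscr J$-classes. For an idempotent $e$, the maximal subgroup at $e$ is the group of units $G_e$ of $eSe$. Let $J_1,\dots,J_n$ be the $\mathscr J$-classes of $S$; fix idempotents $e_i\in J_i$ and let $G_i=G_{e_i}$. Put $J_i^{\downarrow}=\{s\in S: s<_{\mathscr J}e_i\}$, an ideal of $S$ (so $kJ_i^{\downarrow}$, its linear span, is an ideal of $kS$). Then $e_i(kS/kJ_i^{\downarrow})e_i\cong kG_i$. For a $kG_i$-module $V$ put $\mathrm{Ind}_i(V)=V\otimes_{kG_i}e_i(kS/kJ_i^{\downarrow})$, a right $kS$-module. $kS$ is called directed if the characteristic of $k$ does not divide the order of any maximal subgroup of $S$ and, for every $i$ and every simple $kG_i$-module $V$, the $kS$-module $\mathrm{Ind}_i(V)$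 is projective. Sandwich matrix: let $R_i$ and $L_i$ be the $\mathscr R$-class and $\mathscr L$-class of $e_i$. Choose representatives $\lambda_b\in R_i$, one for each $\mathscr L$-class $b$ contained in $J_i$, and $\rho_a\in L_i$, one for each $\mathscr R$-class $a$ contained in $J_i$. The sandwich matrix $C_i$ has rows indexed by the $\mathscr L$-classes $b$ and columns by the $\mathscr R$-classes $a$ of $J_i$, with $(C_i)_{ba}=\lambda_b\rho_a$ if $\lambda_b\rho_a\in J_i$ and $(C_i)_{ba}=0$ otherwise; its entries lie in $G_i\cup\{0\}\subseteq kG_i$. Left invertible means there is a matrix $D$ over $kG_i$ with $DC_i$ the identity matrix. The length of a chain is the number of $\mathscr J$-classes in it. A $\mathscr J$-class is non-zero unless it is $\{z\}$ with $z$ a zero element of $S$ and $S$ has more than one element. *)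

(* Defs.v *)
From HB Require Import structures.
From mathcomp Require Import all_boot.

(* Declared before the finite group library is loaded: Hierarchy Builder      *)
(* refuses this join once finStarMonoidType, which is not above it, exists.   *)
#[short(type="finMonoidType")]
HB.structure Definition FinMonoid := {S of Monoid S & Finite S}.

From mathcomp Require Import all_order all_algebra all_fingroup.
From mathcomp Require Import generic_quotient ring_quotient boolp.
From mathcomp Require Import freeg.

Set Implicit Arguments.
Unset Strict Implicit.
Unset Printing Implicit Defensive.

Import GRing.Theory.
Local Open Scope ring_scope.

(* A right A-module is a left module over the converse ring: v a is a *: v.   *)
Notation rmodType A := (lmodType A^c).

Section ModuleNotions.
Variable R : nzRingType.

Definition fin_gen (M : lmodType R) : Prop :=
  exists (n : nat) (g : 'I_n -> M),
    forall x, exists c : 'I_n -> R, x = \sum_(i < n) c i *: g i.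

Definition simple_module (M : lmodType R) : Prop :=
  (exists x : M, x != 0) /\
  forall N : submodClosed M,
    (forall x, x \in N -> x = 0) \/ (forall x, x \in N).

Definition projective (P : lmodType R) : Prop :=
  forall (X Y : lmodType R) (p : {linear X -> Y}) (f : {linear P -> Y}),
    (forall y, exists x, p x = y) ->
    exists h : {linear P -> X}, forall x, p (h x) = f x.

(* There is an exact sequence 0 -> P_d -> ... -> P_1 -> P_0 -> M -> 0 with    *)
(* all P_i finitely generated projective; it is padded with P_i = 0 for i > d.*)
Definition proj_dim_le (M : lmodType R) (d : nat) : Prop :=
  exists (P : nat -> lmodType R)
         (bd : forall i, {linear P i.+1 -> P i}) (aug : {linear P 0 -> M}),
    [/\ forall i, fin_gen (P i) /\ projective (P i),
        forall i, (d < i)%N -> forall x : P i, x = 0,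
        forall y, exists x, aug x = y,
        forall x, aug x = 0 <-> exists y, bd 0 y = x &
        forall i x, bd i x = 0 <-> exists y, bd i.+1 y = x].

End ModuleNotions.

(* Global dimension with respect to finitely generated right modules.         *)
Definition gl_dim_le (A : nzRingType) (d : nat) : Prop :=
  forall M : rmodType A, fin_gen M -> proj_dim_le M d.

Section QuotientModule.
Variables (R : nzRingType) (M : lmodType R) (N : submodClosed M).

Definition submod_pred : {pred M} := [pred x | x \in N].

Fact submod_pred_zmod : zmod_closed submod_pred.
Proof.
have [N0 Nlin] := submodClosedP N.
split=> [|x y Nx Ny]; rewrite !inE //.
by rewrite addrC -scaleN1r Nlin.
Qed.
HB.instance Definition _ := GRing.isZmodClosed.Build M submod_pred
  submod_pred_zmod.

Definition quot_mod := Quotient.quot submod_pred.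

HB.instance Definition _ := GRing.Zmodule.on quot_mod.

Definition quot_pi (x : M) : quot_mod := \pi_(Quotient.quot submod_pred)%qT x.
Definition quot_repr (x : quot_mod) : M :=
  repr (x : Quotient.quot submod_pred).

Lemma quot_reprK x : quot_pi (quot_repr x) = x.
Proof. exact: reprK. Qed.

Lemma quot_piE x y : (quot_pi x = quot_pi y) <-> (x - y \in N).
Proof.
rewrite /quot_pi; split=> [/eqP|xyN]; last apply/eqP;
  by rewrite -Quotient.idealrBE.
Qed.

Lemma quot_piD x y : quot_pi (x + y) = quot_pi x + quot_pi y.
Proof. exact: Quotient.pi_add. Qed.

Definition quot_scale (r : R) (x : quot_mod) := quot_pi (r *: quot_repr x).

Lemma quot_scale_pi r x : quot_scale r (quot_pi x) = quot_pi (r *: x).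
Proof.
apply/quot_piE; rewrite -scalerBr rpredZ //; apply/quot_piE.
exact: quot_reprK.
Qed.

Fact quot_scaleA r s x : quot_scale r (quot_scale s x) = quot_scale (r * s) x.
Proof. by rewrite -[x]quot_reprK !quot_scale_pi scalerA. Qed.
Fact quot_scale1 : left_id 1 quot_scale.
Proof. by move=> x; rewrite -[x]quot_reprK quot_scale_pi scale1r. Qed.
Fact quot_scaleDr : right_distributive quot_scale +%R.
Proof.
move=> r x y; rewrite -[x]quot_reprK -[y]quot_reprK -quot_piD !quot_scale_pi.
by rewrite scalerDr quot_piD.
Qed.
Fact quot_scaleDl x : {morph quot_scale^~ x : r s / r + s}.
Proof.
by move=> r s; rewrite -[x]quot_reprK !quot_scale_pi scalerDl quot_piD.
Qed.
HB.instance Definition _ := GRing.Zmodule_isLmodule.Build R quot_mod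
  quot_scaleA quot_scale1 quot_scaleDr quot_scaleDl.

Fact quot_pi_linear : linear quot_pi.
Proof. by move=> r x y; rewrite quot_piD -quot_scale_pi. Qed.
HB.instance Definition _ :=
  GRing.isLinear.Build R M quot_mod _ quot_pi quot_pi_linear.

End QuotientModule.

Section SpannedSubmodule.
Variables (R : nzRingType) (M : lmodType R) (X : M -> Prop).

Definition spanned : {pred M} :=
  [pred x | `[< forall N : submodClosed M, (forall y, X y -> y \in N) -> x \in N >]].

Fact spanned_submod : submod_closed spanned.
Proof.
split=> [|a x y /asboolP Hx /asboolP Hy]; apply/asboolP=> N XN.
  exact: rpred0.
by rewrite rpredD ?rpredZ ?Hx ?Hy.
Qed.
HB.instance Definition _ := GRing.isSubmodClosed.Build R M spanned
  spanned_submod.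

End SpannedSubmodule.

Record bimodule (A R : nzRingType) := Bimodule {
  bimod_car :> rmodType R;
  lact : A -> bimod_car -> bimod_car;
  lactDl : forall a b x, lact (a + b) x = lact a x + lact b x;
  lactDr : forall a x y, lact a (x + y) = lact a x + lact a y;
  lact1 : forall x, lact 1 x = x;
  lactM : forall a b x, lact (a * b) x = lact a (lact b x);
  lactZ : forall a (r : R^c) x, lact a (r *: x) = r *: lact a x
}.

Section RegularBimodule.
Variable A : nzRingType.

Definition regular_bimodule : bimodule A A :=
  @Bimodule A A (A^c)^o (fun a x => (a : A) * x)
    (fun a b x => mulrDl (a : A) b x) (fun a x y => mulrDr (a : A) x y)
    (fun x => mul1r (x : A)) (fun a b x => esym (mulrA (a : A) b x))
    (fun a r x => mulrA (a : A) x r).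

End RegularBimodule.

Section QuotientBimodule.
Variables (A R : nzRingType) (B : bimodule A R) (N : submodClosed B).
Hypothesis N_stable : forall a x, x \in N -> lact a x \in N.

Definition quot_lact (a : A) (x : quot_mod N) : quot_mod N :=
  quot_pi N (lact a (quot_repr x)).

Lemma quot_lact_pi a x : quot_lact a (quot_pi N x) = quot_pi N (lact a x).
Proof.
apply/quot_piE; set y := quot_repr _.
have -> : lact a y - lact a x = lact a (y - x).
  by rewrite lactDr -[in RHS]scaleN1r lactZ scaleN1r.
by apply/N_stable/quot_piE; rewrite quot_reprK.
Qed.

Fact quot_lactDl a b x : quot_lact (a + b) x = quot_lact a x + quot_lact b x.
Proof. by rewrite -[x]quot_reprK !quot_lact_pi lactDl raddfD. Qed.
Fact quot_lactDr a x y : quot_lact a (x + y) = quot_lact a x + quot_lact a y.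
Proof.
rewrite -[x]quot_reprK -[y]quot_reprK -raddfD !quot_lact_pi.
by rewrite lactDr raddfD.
Qed.
Fact quot_lact1 x : quot_lact 1 x = x.
Proof. by rewrite -[x]quot_reprK quot_lact_pi lact1. Qed.
Fact quot_lactM a b x : quot_lact (a * b) x = quot_lact a (quot_lact b x).
Proof. by rewrite -[x]quot_reprK !quot_lact_pi lactM. Qed.
Fact quot_lactZ a (r : R^c) x : quot_lact a (r *: x) = r *: quot_lact a x.
Proof.
by rewrite -[x]quot_reprK -linearZ !quot_lact_pi lactZ linearZ.
Qed.

Definition quot_bimodule : bimodule A R :=
  Bimodule quot_lactDl quot_lactDr quot_lact1 quot_lactM quot_lactZ.

End QuotientBimodule.

(* For a map phi : A' -> A that preserves sums and products but sends 1 to an *)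
(* idempotent c, the (A', R)-bimodule c B = {x in B | c x = x}.               *)
Section CornerBimodule.
Variables (A A' R : nzRingType) (B : bimodule A R) (phi : A' -> A).
Hypothesis phiD : {morph phi : a b / a + b}.
Hypothesis phiM : {morph phi : a b / a * b}.

Definition corner_pred : {pred B} := [pred x | lact (phi 1) x == x].

Fact corner_submod : submod_closed corner_pred.
Proof.
split=> [|r x y /eqP Hx /eqP Hy]; rewrite !inE.
  by rewrite -[0](scale0r (0 : B)) lactZ !scale0r.
by rewrite lactDr lactZ Hx Hy.
Qed.
HB.instance Definition _ := GRing.isSubmodClosed.Build R^c B corner_pred
  corner_submod.

Record corner := Corner { corner_val : B; _ : corner_val \in corner_pred }.

HB.instance Definition _ := [isSub for corner_val].
HB.instance Definition _ := [Choice of corner by <:].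
HB.instance Definition _ := [SubChoice_isSubLmodule of corner by <:].

Fact corner_lact_subproof a (x : corner) :
  lact (phi a) (val x) \in corner_pred.
Proof. by rewrite inE -lactM -phiM mul1r. Qed.

Definition corner_lact a (x : corner) : corner :=
  Corner (corner_lact_subproof a x).

Fact corner_lactDl a b x :
  corner_lact (a + b) x = corner_lact a x + corner_lact b x.
Proof. by apply: val_inj; rewrite raddfD /= phiD lactDl. Qed.
Fact corner_lactDr a x y :
  corner_lact a (x + y) = corner_lact a x + corner_lact a y.
Proof. by apply: val_inj; rewrite /= -lactDr; congr lact; exact: raddfD. Qed.
Fact corner_lact1 x : corner_lact 1 x = x.
Proof. by apply: val_inj; apply/eqP; case: x. Qed.
Fact corner_lactM a b x : corner_lact (a * b) x = corner_lact a (corner_lact b x).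
Proof. by apply: val_inj; rewrite /= phiM lactM. Qed.
Fact corner_lactZ a (r : R^c) x : corner_lact a (r *: x) = r *: corner_lact a x.
Proof. by apply: val_inj; rewrite /= -lactZ. Qed.

Definition corner_bimodule : bimodule A' R :=
  Bimodule corner_lactDl corner_lactDr corner_lact1 corner_lactM corner_lactZ.

End CornerBimodule.

(* V (x)_A B for a right A-module V and an (A, R)-bimodule B, presented as a  *)
(* right R-module: the symbols v (x) b generate it subject to biadditivity,   *)
(* A-balancedness and v (x) (b r) = (v (x) b) r.                              *)
Section Tensor.
Variables (A R : nzRingType) (V : rmodType A) (B : bimodule A R).

Definition tensor_sym (v : V) (b : B) : {freeg (V * B) / R^c} :=
  [freeg [:: (1, (v, b))]].

Inductive tensor_rel : {freeg (V * B) / R^c} -> Prop :=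
| TensorDl v w b :
    tensor_rel (tensor_sym (v + w) b - (tensor_sym v b + tensor_sym w b))
| TensorDr v b c :
    tensor_rel (tensor_sym v (b + c) - (tensor_sym v b + tensor_sym v c))
| TensorA v (a : A) b :
    tensor_rel (tensor_sym ((a : A^c) *: v) b - tensor_sym v (lact a b))
| TensorZ v b (r : R^c) :
    tensor_rel (tensor_sym v (r *: b) - r *: tensor_sym v b).

Definition tensor : rmodType R := quot_mod (spanned tensor_rel).

Definition tens (v : V) (b : B) : tensor :=
  quot_pi (spanned tensor_rel) (tensor_sym v b).

End Tensor.

Section Green.
Variable S : finMonoidType.
Implicit Types (s t x y : S) (X : {set S}).
Local Open Scope group_scope.

Definition regular_monoid : Prop := forall s, exists t, s * t * s = s.

Definition idealJ s : {set S} := [set x * s * y | x : S, y : S].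
Definition idealR s : {set S} := [set s * x | x : S].
Definition idealL s : {set S} := [set x * s | x : S].

Definition leJ s t := idealJ s \subset idealJ t.
Definition leR s t := idealR s \subset idealR t.
Definition leL s t := idealL s \subset idealL t.

Definition Jclass s : {set S} := [set t | leJ t s && leJ s t].
Definition Rclass s : {set S} := [set t | leR t s && leR s t].
Definition Lclass s : {set S} := [set t | leL t s && leL s t].

Definition Jdown s : {set S} := [set t | leJ t s && ~~ leJ s t].

Definition Jclasses : {set {set S}} := [set Jclass s | s : S].
(* The R-classes, resp. L-classes, contained in the J-class of s.             *)
Definition Rclasses_of s : {set {set S}} := [set Rclass t | t in Jclass s].
Definition Lclasses_of s : {set {set S}} := [set Lclass t | t in Jclass s].

Definition zero_element z : bool := [forall x : S, (z * x == z) && (x * z == z)].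

Definition nonzero_Jclass X : bool :=
  ~~ ((1 < #|S|)%N && [exists z : S, zero_element z && (X == [set z])]).

Definition leJclass (X Y : {set S}) : bool :=
  [forall s in X, forall t in Y, leJ s t].

Definition nonzero_Jchain (C : {set {set S}}) : bool :=
  [&& C \subset Jclasses, [forall X in C, nonzero_Jclass X] &
      [forall X in C, forall Y in C, leJclass X Y || leJclass Y X]].

Definition longest_nonzero_Jchain : nat :=
  (\max_(C : {set {set S}} | nonzero_Jchain C) #|C|)%N.

Lemma idealJP s t : reflect (exists x y : S, t = x * s * y) (t \in idealJ s).
Proof.
apply: (iffP imset2P) => [[x y _ _ ->]|[x [y ->]]]; first by exists x, y.
by exists x y.
Qed.

Lemma leJP s t : reflect (exists x y : S, s = x * t * y) (leJ s t).
Proof.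
apply: (iffP idP) => [/subsetP/(_ s)|[x [y ->]]].
  move=> st; apply/idealJP/st; apply/idealJP.
  by exists 1, 1; rewrite mul1g mulg1.
apply/subsetP=> _ /idealJP[u [v ->]]; apply/idealJP.
by exists (u * x), (y * v); rewrite !mulgA.
Qed.

Lemma Jdown_ideal s t u v : t \in Jdown s -> u * t * v \in Jdown s.
Proof.
rewrite !inE => /andP[ts nst].
have uvt : leJ (u * t * v) t by apply/leJP; exists u, v.
apply/andP; split; first exact: subset_trans uvt ts.
by apply: contra nst => st; apply: subset_trans st uvt.
Qed.

End Green.

Record idem_of (S : finMonoidType) := Idempotent {
  idem_val :> S;
  idem_mul : (idem_val * idem_val)%g = idem_val
}.

Section MaximalSubgroup.
Variable S : finMonoidType.
Local Open Scope group_scope.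

Definition local_inverse (e x y : S) : bool :=
  [&& e * y == y, y * e == y, x * y == e & y * x == e].

(* For e idempotent, the units of the monoid e S e, whose identity is e.      *)
Definition maxgroup_pred (e : S) : {pred S} :=
  [pred x | [&& e * x == x, x * e == x & [exists y : S, local_inverse e x y]]].

Variable e : idem_of S.

Record maxgroup := MaxGroup { mg_val :> S; _ : mg_val \in maxgroup_pred e }.

HB.instance Definition _ := [isSub for mg_val].
HB.instance Definition _ := [Finite of maxgroup by <:].

Lemma maxgroupP (g : maxgroup) :
  [/\ (e : S) * (g : S) = g :> S, (g : S) * (e : S) = g :> S & exists y, local_inverse e g y].
Proof. by case: g => g /= /and3P[/eqP ? /eqP ? /existsP]. Qed.

Fact mg_one_subproof : (e : S) \in maxgroup_pred e.
Proof.
rewrite inE idem_mul eqxx /=; apply/existsP; exists (e : S).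
by rewrite /local_inverse idem_mul eqxx.
Qed.
Definition mg_one : maxgroup := MaxGroup mg_one_subproof.

Fact mg_mul_subproof (g h : maxgroup) : (g : S) * (h : S) \in maxgroup_pred e.
Proof.
have [eg ge [g' /and4P[/eqP eg' /eqP g'e /eqP gg' /eqP g'g]]] := maxgroupP g.
have [eh he [h' /and4P[/eqP eh' /eqP h'e /eqP hh' /eqP h'h]]] := maxgroupP h.
rewrite inE mulgA eg -mulgA he !eqxx /=; apply/existsP; exists (h' * g').
apply/and4P; split; apply/eqP.
- by rewrite mulgA eh'.
- by rewrite -mulgA g'e.
- by rewrite mulgA -(mulgA (g : S)) hh' ge.
- by rewrite mulgA -(mulgA h') g'g h'e.
Qed.
Definition mg_mul (g h : maxgroup) : maxgroup := MaxGroup (mg_mul_subproof g h).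

Definition mg_inv_val (g : maxgroup) : S :=
  odflt (e : S) [pick y | local_inverse e g y].

Lemma mg_inv_valP (g : maxgroup) : local_inverse e g (mg_inv_val g).
Proof.
rewrite /mg_inv_val; case: pickP => //= no_y.
by have [_ _ [y]] := maxgroupP g; rewrite no_y.
Qed.

Fact mg_inv_subproof (g : maxgroup) : mg_inv_val g \in maxgroup_pred e.
Proof.
have [eg ge _] := maxgroupP g.
have /and4P[ey ye gy yg] := mg_inv_valP g.
rewrite inE ey ye; apply/existsP; exists (g : S).
by rewrite /local_inverse eg ge !eqxx yg gy.
Qed.
Definition mg_inv (g : maxgroup) : maxgroup := MaxGroup (mg_inv_subproof g).

Fact mg_mulA : associative mg_mul.
Proof. by move=> x y z; apply: val_inj; rewrite /= mulgA. Qed.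
Fact mg_mul1g : left_id mg_one mg_mul.
Proof. by move=> x; apply: val_inj; case: (maxgroupP x). Qed.
Fact mg_mulg1 : right_id mg_one mg_mul.
Proof. by move=> x; apply: val_inj; case: (maxgroupP x). Qed.
Fact mg_mulVg : left_inverse mg_one mg_inv mg_mul.
Proof.
by move=> x; apply: val_inj; case/and4P: (mg_inv_valP x) => _ _ _ /eqP.
Qed.
Fact mg_mulgV : right_inverse mg_one mg_inv mg_mul.
Proof.
by move=> x; apply: val_inj; case/and4P: (mg_inv_valP x) => _ _ /eqP.
Qed.
HB.instance Definition _ := isGroup.Build maxgroup
  mg_mulA mg_mul1g mg_mulg1 mg_mulVg mg_mulgV.

End MaximalSubgroup.

Definition monalgebra (k : fieldType) (S : finMonoidType) := {ffun S -> k}.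

Section MonoidAlgebra.
Variables (k : fieldType) (S : finMonoidType).
Local Notation kS := (monalgebra k S).
Implicit Types x y z : kS.

HB.instance Definition _ := GRing.Lmodule.copy kS {ffun S -> k^o}.

Definition ma_basis (s : S) : kS := [ffun t => (t == s)%:R].

Definition ma_mul x y : kS :=
  [ffun s => \sum_(p : S * S | (p.1 * p.2)%g == s) x p.1 * y p.2].

Lemma ma_mulE x y (s : S) :
  ma_mul x y s = \sum_a \sum_b x a * y b * ((a * b)%g == s)%:R.
Proof.
rewrite ffunE pair_big [LHS]big_mkcond /=; apply: eq_bigr => -[a b] _ /=.
by case: eqP; rewrite ?mulr1 ?mulr0.
Qed.

Fact ma_mulA : associative ma_mul.
Proof.
move=> x y z; apply/ffunP=> s; rewrite !ma_mulE.
transitivity (\sum_a \sum_b \sum_c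
    x a * y b * z c * ((a * b * c)%g == s)%:R).
  apply: eq_bigr => a _.
  under eq_bigr => d _ do rewrite ma_mulE mulr_sumr mulr_suml.
  rewrite exchange_big; apply: eq_bigr => b _ /=.
  under eq_bigr => d _ do rewrite mulr_sumr mulr_suml.
  rewrite exchange_big; apply: eq_bigr => c _ /=.
  rewrite (bigD1 (b * c)%g) //= big1 ?addr0 => [|d /negPf nd]; last first.
    by rewrite [_ == d]eq_sym nd mulr0 mulr0 mul0r.
  by rewrite eqxx mulr1 !mulrA mulgA.
symmetry.
under eq_bigr => d _.
  under eq_bigr => c _ do rewrite ma_mulE -mulrA mulr_suml.
  over.
under eq_bigr => d _.
  rewrite exchange_big; under eq_bigr => a _.
    under eq_bigr => c _ do rewrite mulr_suml.
    rewrite exchange_big; over.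
  over.
rewrite exchange_big; apply: eq_bigr => a _ /=.
rewrite exchange_big; apply: eq_bigr => b _ /=.
rewrite exchange_big; apply: eq_bigr => c _ /=.
rewrite (bigD1 (a * b)%g) //= big1 ?addr0 => [|d /negPf nd]; last first.
  by rewrite [_ == d]eq_sym nd mulr0 mul0r.
by rewrite eqxx mulr1 mulrA.
Qed.

Fact ma_mul1 : left_id (ma_basis 1%g) ma_mul.
Proof.
move=> x; apply/ffunP=> s; rewrite ma_mulE (bigD1 1%g) //= [X in _ + X]big1.
  rewrite addr0 (bigD1 s) //= big1 => [|t /negPf nt].
    by rewrite ffunE eqxx mul1g eqxx mul1r mulr1 addr0.
  by rewrite mul1g nt mulr0.
by move=> t /negPf nt; apply: big1 => b _; rewrite ffunE nt !mul0r.
Qed.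

Fact ma_mulr1 : right_id (ma_basis 1%g) ma_mul.
Proof.
move=> x; apply/ffunP=> s; rewrite ma_mulE exchange_big.
rewrite (bigD1 1%g) //= [X in _ + X]big1.
  rewrite addr0 (bigD1 s) //= big1 => [|t /negPf nt].
    by rewrite ffunE eqxx mulg1 eqxx !mulr1 addr0.
  by rewrite mulg1 nt mulr0.
by move=> t /negPf nt; apply: big1 => b _; rewrite ffunE nt mulr0 mul0r.
Qed.

Fact ma_mulDl : left_distributive ma_mul +%R.
Proof.
move=> x y z; apply/ffunP=> s; rewrite !ffunE -big_split.
by apply: eq_bigr => p _; rewrite ffunE mulrDl.
Qed.

Fact ma_mulDr : right_distributive ma_mul +%R.
Proof.
move=> x y z; apply/ffunP=> s; rewrite !ffunE -big_split.
by apply: eq_bigr => p _; rewrite ffunE mulrDr.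
Qed.

Fact ma_1neq0 : ma_basis 1%g != 0.
Proof.
apply/eqP=> /ffunP/(_ 1%g); rewrite !ffunE eqxx => /eqP.
by rewrite oner_eq0.
Qed.

HB.instance Definition _ := GRing.Zmodule_isNzRing.Build kS
  ma_mulA ma_mul1 ma_mulr1 ma_mulDl ma_mulDr ma_1neq0.

Lemma mulmaE x y (s : S) :
  (x * y) s = \sum_a \sum_b x a * y b * ((a * b)%g == s)%:R.
Proof. exact: ma_mulE. Qed.

Lemma ma_basisM (s t : S) :
  ma_basis s * ma_basis t = ma_basis (s * t)%g.
Proof.
apply/ffunP=> u; rewrite [LHS]mulmaE.
rewrite (bigD1 s) //= [X in _ + X]big1 => [|a /negPf na]; last first.
  by apply: big1 => b _; rewrite ffunE na !mul0r.
rewrite (bigD1 t) //= big1 => [|b /negPf nb]; last first.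
  by rewrite [X in _ * X * _]ffunE nb mulr0 mul0r.
by rewrite !ffunE !eqxx !addr0 !mul1r eq_sym.
Qed.

Lemma ma_scaleE (c : k) x s : (c *: x) s = c * x s.
Proof. by rewrite ffunE. Qed.

Lemma ma_scaleAl (c : k) x y : (c *: x) * y = c *: (x * y).
Proof.
apply/ffunP=> s; rewrite ma_scaleE !mulmaE mulr_sumr.
apply: eq_bigr => a _; rewrite mulr_sumr.
by apply: eq_bigr => b _; rewrite ma_scaleE !mulrA.
Qed.

Lemma ma_scaleAr (c : k) x y : x * (c *: y) = c *: (x * y).
Proof.
apply/ffunP=> s; rewrite ma_scaleE !mulmaE mulr_sumr.
apply: eq_bigr => a _; rewrite mulr_sumr.
by apply: eq_bigr => b _; rewrite ma_scaleE !mulrA [x a * c]mulrC.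
Qed.

HB.instance Definition _ := GRing.Lmodule_isLalgebra.Build k kS
  (fun c x y => esym (ma_scaleAl c x y)).
HB.instance Definition _ := GRing.Lalgebra_isAlgebra.Build k kS
  (fun c x y => esym (ma_scaleAr c x y)).

End MonoidAlgebra.

Section Induction.
Variables (k : fieldType) (S : finMonoidType) (e : idem_of S).
Local Notation kS := (monalgebra k S).
Local Notation kG := (monalgebra k (maxgroup e)).

(* The linear span of Jdown e, as a subset of kS.                             *)
Definition kJdown : {pred regular_bimodule kS} :=
  [pred x : kS | [forall s, (s \notin Jdown e) ==> (x s == 0)]].

Lemma kJdownP (x : kS) :
  reflect (forall s, s \notin Jdown e -> x s = 0) (x \in kJdown).
Proof.
by apply: (iffP 'forall_implyP) => H s /H /eqP.
Qed.

Lemma kJdown_mul (a x b : kS) : x \in kJdown -> a * x * b \in kJdown.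
Proof.
move=> /kJdownP Hx; apply/kJdownP=> s Hs.
rewrite [LHS]ffunE big1 // => -[u v] /= /eqP uv; rewrite [X in X * _]ffunE.
rewrite big1 ?mul0r // => -[c d] /= /eqP cd; rewrite Hx ?mulr0 //.
by apply: contra Hs => Hd; rewrite -uv -cd Jdown_ideal.
Qed.

Fact kJdown_submod : submod_closed kJdown.
Proof.
split=> [|a x y Hx Hy]; first by apply/kJdownP=> s _; rewrite ffunE.
have /kJdownP Hxa := kJdown_mul 1 a Hx; move/kJdownP: Hy => Hy.
apply/kJdownP=> s Hs; rewrite ffunE Hy // addr0.
by have := Hxa s Hs; rewrite mul1r.
Qed.
HB.instance Definition _ := GRing.isSubmodClosed.Build kS^c
  (regular_bimodule kS) kJdown kJdown_submod.

Fact kJdown_stable (a : kS) (x : regular_bimodule kS) :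
  x \in kJdown -> lact a x \in kJdown.
Proof. by move=> /(kJdown_mul a 1); rewrite mulr1. Qed.

Definition Jquotient : bimodule kS kS := quot_bimodule kJdown_stable.

(* The inclusion of kG in kS; it sends the identity of kG to e.               *)
Definition maxgroup_incl (x : kG) : kS :=
  \sum_(g : maxgroup e) x g *: ma_basis k (g : S).

Fact maxgroup_inclD : {morph maxgroup_incl : x y / x + y}.
Proof.
move=> x y; rewrite -big_split; apply: eq_bigr => g _ /=.
by rewrite ffunE scalerDl.
Qed.

Fact maxgroup_inclM : {morph maxgroup_incl : x y / x * y}.
Proof.
move=> x y; rewrite /maxgroup_incl mulr_suml.
under [RHS]eq_bigr => g _ do rewrite mulr_sumr.
under [LHS]eq_bigr => g _ do rewrite [_ g]mulmaE scaler_suml.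
rewrite exchange_big; apply: eq_bigr => a _ /=.
under [LHS]eq_bigr => g _ do rewrite scaler_suml.
rewrite exchange_big; apply: eq_bigr => b _ /=.
rewrite (bigD1 (a * b)%g) //= big1 ?addr0 => [|g /negPf ng]; last first.
  by rewrite [_ == g]eq_sym ng mulr0 scale0r.
by rewrite eqxx mulr1 ma_scaleAl ma_scaleAr ma_basisM scalerA.
Qed.

(* e (kS / kJdown(e)) as a (kG, kS)-bimodule.                                 *)
Definition ind_bimodule : bimodule kG kS :=
  @corner_bimodule _ _ _ Jquotient _ maxgroup_inclD maxgroup_inclM.

Definition Ind (V : rmodType kG) : rmodType kS := tensor V ind_bimodule.

End Induction.

Definition good_char (k : fieldType) (S : finMonoidType) : Prop :=
  forall (e : idem_of S) (p : nat),
    p \in [pchar k] -> ~~ (p %| #|{: maxgroup e}|)%N.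

(* e picks one idempotent in each J-class.                                    *)
Definition Jtransversal (S : finMonoidType) n (e : 'I_n -> idem_of S) : Prop :=
  forall s : S, exists! i, s \in Jclass (e i).

Definition directed (k : fieldType) (S : finMonoidType) n
    (e : 'I_n -> idem_of S) : Prop :=
  good_char k S /\
  forall (i : 'I_n) (V : rmodType (monalgebra k (maxgroup (e i)))),
    simple_module V -> projective (Ind V).

Definition Lrepresentatives (S : finMonoidType) (e : S) (lam : {set S} -> S) :=
  forall b, b \in Lclasses_of e -> lam b \in b :&: Rclass e.

Definition Rrepresentatives (S : finMonoidType) (e : S) (rho : {set S} -> S) :=
  forall a, a \in Rclasses_of e -> rho a \in a :&: Lclass e.

(* When lam and rho are representatives as above, lam b * rho a lies in the   *)
(* maximal subgroup as soon as it lies in the J-class of e, so that the       *)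
(* default value of insubd is never used.                                     *)
Definition sandwich (k : fieldType) (S : finMonoidType) (e : idem_of S)
    (lam rho : {set S} -> S) :
    'M[monalgebra k (maxgroup e)]_(#|Lclasses_of e|, #|Rclasses_of e|) :=
  \matrix_(b, a)
    let x := (lam (enum_val b) * rho (enum_val a))%g in
    if x \in Jclass e then ma_basis k (insubd (mg_one e) x) else 0.

Definition left_invertible (R : nzRingType) p q (C : 'M[R]_(p, q)) : Prop :=
  exists D : 'M[R]_(q, p), D *m C = 1%:M.

(* Main.v *)
(* For an ideal I of S let kI be its linear span. Everything goes through the *)
(* condition (L) that every kI has a left identity, i.e. kI = eta kS.         *)
(*                                                                            *)
(* C_i is left invertible iff kJ_i, modulo the span of the strictly lower     *)
(* elements, has a left identity (DC = 1 says that D is one in the Munn       *)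
(* algebra), and 1 - eta = (1 - eta')(1 - theta) glues these left identities  *)
(* along the ideals of S; so (L) holds iff every C_i is left invertible.      *)
(*                                                                            *)
(* Ind_i(V) is projective for all simple V iff there is eps in kS congruent   *)
(* to e_i modulo the lower span kJ and killing it, i.e. kS -> e_i(kS/kJ)      *)
(* splits. Given (L), eps = e_i - e_i eta works, by averaging over G_i.       *)
(* Conversely, eps retracts the span of an ideal to that of the ideal         *)
(* obtained by removing J_i, so (L) follows by descent from kS itself.        *)
(*                                                                            *)
(* For the global dimension, filter S by the ideals I_h of elements of height *)
(* at most h. Left identities c_h of kI_h can be chosen with                  *)
(* c_h c_(h+1) = c_h, so that f_h = c_(h+1) - c_h are orthogonal idempotents  *)
(* for which kS is block triangular with blocks f_h kS f_h, products of       *)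
(* matrix algebras over the kG_i. These blocks T are separable: an explicit   *)
(* tensor t in kS (x) kS commutes with T and multiplies to 1. Hence           *)
(* M (x)_T kS, the image of t acting on M (x)_k kS, is projective, and it     *)
(* covers M with a kernel killed by one more c_h than M.                      *)
From HB Require Import structures.
Require Import Defs.
From mathcomp Require Import all_boot all_order all_algebra.
From mathcomp Require Import boolp.
From mathcomp Require freeg.

Set Implicit Arguments.
Unset Strict Implicit.
Unset Printing Implicit Defensive.

Import GRing.Theory.
Local Open Scope ring_scope.

(** * Finitely generated and projective modules *)

(** Both sides of the equivalence amount to one condition: the span of every ideal of S has a left
    identity ([has_left_id]).

    From directed: the elements of kG_i that lift to elements of kS killing the lower span kJ form a
    right ideal. If it were proper, it would lie in a maximal right ideal M, and projectivity of
    Ind(kG_i/M) would produce a member of it outside M. So 1 lifts ([split_of_projective]), and left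
    identities descend from kS to all ideals ([left_id_of_split]). Cutting a left identity of the
    ideal generated by e_i into its R-class components gives the rows of a left inverse of C_i
    ([left_invertible_of_left_id]).

    From left inverses D of the C_i: the sum of the rho_a D_ab lam_b is a left identity modulo lower
    elements ([local_of_left_invertible]); these are glued ([left_id_of_local]), they split off
    e_i(kS/kJ) ([split_of_left_id]), and averaging over G_i transfers this to every Ind_i(V)
    ([Ind_projective]).

    Global dimension: nested left identities 0 = c_0, ..., c_N = 1 make kS block triangular over the
    algebra T of elements commuting with all c_h, and T has a separability tensor
    ([diagonal_tensor]). Covering M by M (x)_T kS turns a module killed by c_h into a kernel killed
    by c_(h+1), so the N-th syzygy vanishes ([gl_dim_le_tensor]). A zero of S adds a level, but c_1
    is then central and can be skipped ([gl_dim_le_level_zero]). *)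

(** A generating family of least size is free, since a nontrivial relation would eliminate one of
    its members; hence its coordinates are unique and therefore linear. *)
Lemma fin_gen_coord (k : fieldType) (V : lmodType k) :
  fin_gen V ->
  exists d (b : 'I_d -> V) (co : {linear V -> 'rV[k]_d}),
    forall v, v = \sum_i co v 0 i *: b i.
Proof.
move=> fgV.
pose P d := `[< exists b : 'I_d -> V,
  forall v, exists c : 'I_d -> k, v = \sum_i c i *: b i >].
have exP : exists d, P d.
  by case: fgV => d [b Hb]; exists d; apply/asboolP; exists b.
case: (ex_minnP exP) => d /asboolP[b Hb] min_d; exists d, b.
have [co Hco] := choice Hb.
have free_b (c : 'I_d -> k) : \sum_i c i *: b i = 0 -> forall i, c i = 0.
  move=> c0 j; apply/eqP/negP=> /negP cj.
  case: d => [|d] in b Hb min_d co Hco c c0 j cj *; first by case: j cj.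
  suff: P d by move/min_d; rewrite ltnn.
  apply/asboolP; exists (fun i => b (fintype.lift j i)) => v.
  have [a Ha] := Hb v.
  exists (fun i => a (fintype.lift j i) - a j / c j * c (fintype.lift j i)).
  have -> : v = \sum_i (a i - a j / c j * c i) *: b i.
    have : v = v - (a j / c j) *: \sum_i c i *: b i by rewrite c0 scaler0 subr0.
    rewrite {2}Ha scaler_sumr -sumrB => ->.
    by apply: eq_bigr => i _; rewrite scalerA scalerBl.
  by rewrite (bigD1_ord j) //= divfK // subrr scale0r add0r.
have co_lin : linear (fun v => \row_i co v i : 'rV[k]_d).
  move=> a u v; apply/rowP=> i; rewrite !mxE; apply/eqP; rewrite -subr_eq0.
  apply/eqP; move: i; apply: free_b.
  under eq_bigr => i _ do rewrite scalerBl scalerDl -scalerA.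
  by rewrite sumrB big_split -scaler_sumr -!Hco subrr.
pose lco := GRing.isLinear.Build k V 'rV[k]_d _ _ co_lin.
pose co' : {linear V -> 'rV[k]_d} := HB.pack (fun v => \row_i co v i) lco.
exists co' => v /=.
by rewrite {1}[v]Hco; apply: eq_bigr => i _; rewrite mxE.
Qed.

Section Submodule.
Variables (R : nzRingType) (M : lmodType R) (N : submodClosed M).

Record submodule := Submodule { submod_val : M; _ : submod_val \in N }.

HB.instance Definition _ := [isSub for submod_val].
HB.instance Definition _ := [Choice of submodule by <:].
HB.instance Definition _ := [SubChoice_isSubLmodule of submodule by <:].

End Submodule.

Section LinearSubmodules.
Variables (R : nzRingType) (M M' : lmodType R).

Section Ker.
Variable f : {linear M -> M'}.
Definition linker : {pred M} := [pred x | f x == 0].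
Fact linker_submod : submod_closed linker.
Proof.
split=> [|a x y]; rewrite !inE ?linear0 // => /eqP fx /eqP fy.
by rewrite linearP fx fy scaler0 addr0.
Qed.
HB.instance Definition _ := GRing.isSubmodClosed.Build R M linker linker_submod.
End Ker.

Section Fix.
Variable f : {linear M -> M}.
Definition linfix : {pred M} := [pred x | f x == x].
Fact linfix_submod : submod_closed linfix.
Proof.
split=> [|a x y]; rewrite !inE ?linear0 // => /eqP fx /eqP fy.
by rewrite linearP fx fy.
Qed.
HB.instance Definition _ := GRing.isSubmodClosed.Build R M linfix linfix_submod.
End Fix.

End LinearSubmodules.

Lemma projective_free (R : nzRingType) d :
  projective ({ffun 'I_d -> R^o} : lmodType R).
Proof.
move=> X Y p f surj.
have /choice[x Hx] : forall i : 'I_d, exists x, p x = f [ffun j => (j == i)%:R].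
  by move=> i; apply: surj.
pose h (c : {ffun 'I_d -> R^o}) : X := \sum_i c i *: x i.
have hlin : linear h.
  move=> a u v; rewrite scaler_sumr -big_split; apply: eq_bigr => i _ /=.
  by rewrite !ffunE scalerDl scalerA.
pose lh := GRing.isLinear.Build R _ X _ h hlin.
pose h' : {linear {ffun 'I_d -> R^o} -> X} := HB.pack h lh.
exists h' => c /=; rewrite linear_sum.
have {2}-> : c = \sum_i (c i : R) *: ([ffun j => (j == i)%:R] : {ffun 'I_d -> R^o}).
  apply/ffunP=> j; rewrite sum_ffunE (bigD1 j) //= big1 => [|i /negPf ni].
    by rewrite !ffunE eqxx addr0 /GRing.scale /= mulr1.
  by rewrite !ffunE eq_sym ni scaler0.
by rewrite linear_sum; apply: eq_bigr => i _; rewrite !linearZ Hx.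
Qed.

Lemma projective_retract (R : nzRingType) (P Q : lmodType R)
    (i : {linear Q -> P}) (r : {linear P -> Q}) :
  cancel i r -> projective P -> projective Q.
Proof.
move=> ri projP X Y p f surj.
have [h Hh] := projP X Y p (f \o r)%FUN surj.
by exists (h \o i)%FUN => x /=; rewrite Hh /= ri.
Qed.

(** * Projective resolutions *)

Section Resolution.
Variable R : nzRingType.

(** A record in [Type], so that [syzygy] can recurse on it. [cover_zero] is what ends the
    resolution: once a syzygy vanishes, so does its cover. *)
Record proj_cover (Z : lmodType R -> Prop) (M : lmodType R) := ProjCover {
  cover_mod : lmodType R;
  cover_map : {linear cover_mod -> M};
  cover_fg : fin_gen cover_mod;
  cover_proj : projective cover_mod;
  cover_surj : forall y, exists x, cover_map x = y;
  cover_zero : (forall y : M, y = 0) -> forall x : cover_mod, x = 0;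
  cover_ker : Z (submodule (linker cover_map))
}.

Variables (H : nat -> lmodType R -> Prop) (d : nat).
Hypothesis step : forall h M, H h M -> proj_cover (H h.+1) M.
Hypothesis vanish : forall h M, H h M -> (d < h)%N -> forall x : M, x = 0.

Section From.
Variables (M : lmodType R) (HM : H 0 M).

Fixpoint syzygy h : {K : lmodType R & H h K} :=
  if h is h'.+1 then
    existT (H h'.+1) _ (cover_ker (step (projT2 (syzygy h'))))
  else existT (H 0) M HM.

Let cov h := step (projT2 (syzygy h)).
Let bd h : {linear cover_mod (cov h.+1) -> cover_mod (cov h)} :=
  (val \o cover_map (cov h.+1))%FUN.

(** The boundary is the cover of the next syzygy followed by its inclusion, so exactness is the
    surjectivity of the covers. *)
Lemma resolution : proj_dim_le M d.
Proof.
exists (fun h => cover_mod (cov h)), bd, (cover_map (cov 0)).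
have exact h x : cover_map (cov h) x = 0 <-> exists y, bd h y = x.
  split=> [x0|[y <-]]; last first.
    by apply/eqP; have := valP (cover_map (cov h.+1) y); rewrite inE.
  have xK : x \in linker (cover_map (cov h)) by rewrite inE x0.
  have [y Hy] := cover_surj (cov h.+1) (Submodule xK).
  by exists y; rewrite /bd /= Hy.
split.
- by move=> h; split; [apply: cover_fg | apply: cover_proj].
- move=> h dh x; apply: cover_zero => y.
  exact: vanish (projT2 (syzygy h)) dh y.
- exact: cover_surj.
- exact: exact.
- move=> h x; rewrite -exact; split=> [bd0|x0]; last first.
    exact: (etrans (congr1 val x0) (raddf0 _)).
  exact: val_inj.
Qed.
End From.
End Resolution.

(** * Right actions and restriction of scalars *)

Definition ract (A : nzRingType) (M : rmodType A) (m : M) (a : A) : M :=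
  (a : A^c) *: m.
Notation "m ** a" := (ract m a) (at level 40, left associativity) : ring_scope.

Section RightAction.
Variables (A : nzRingType) (M : rmodType A).
Implicit Types (m : M) (a : A).

Lemma ractA m a b : m ** a ** b = m ** (a * b).
Proof. exact: (@scalerA A^c). Qed.
Lemma ract1 m : m ** 1 = m.
Proof. exact: (@scale1r A^c). Qed.
Lemma ract0 m : m ** 0 = 0.
Proof. exact: (@scale0r A^c). Qed.
Lemma r0act a : (0 : M) ** a = 0.
Proof. exact: (@scaler0 A^c). Qed.
Lemma ractDl m m' a : (m + m') ** a = m ** a + m' ** a.
Proof. exact: (@scalerDr A^c). Qed.
Lemma ractDr m a b : m ** (a + b) = m ** a + m ** b.
Proof. exact: (@scalerDl A^c). Qed.
Lemma ractBr m a b : m ** (a - b) = m ** a - m ** b.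
Proof. exact: (@scalerBl A^c). Qed.
Lemma ract_suml I (r : seq I) (P : pred I) (F : I -> M) a :
  (\sum_(i <- r | P i) F i) ** a = \sum_(i <- r | P i) F i ** a.
Proof. exact: (@scaler_sumr A^c). Qed.
Lemma ract_sumr I (r : seq I) (P : pred I) (F : I -> A) m :
  m ** (\sum_(i <- r | P i) F i) = \sum_(i <- r | P i) m ** F i.
Proof. exact: (@scaler_suml A^c). Qed.

Lemma linear_ract (N : rmodType A) (f : {linear M -> N}) m a :
  f (m ** a) = f m ** a.
Proof. exact: linearZ. Qed.
End RightAction.

Section Restriction.
Variables (k : fieldType) (A : algType k) (M : rmodType A).

(** The underlying k-space. A separate alias keeps its scaling apart from the scaling by [A^c] that
    [M] already carries. *)
Definition kmod : Type := M.
HB.instance Definition _ := GRing.Zmodule.on kmod.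
Definition kmod_scale (c : k) (m : kmod) : kmod := (m : M) ** c%:A.

Fact kmod_scaleA c c' m : kmod_scale c (kmod_scale c' m) = kmod_scale (c * c') m.
Proof. by rewrite /kmod_scale ractA -scalerAl mul1r scalerA mulrC. Qed.
Fact kmod_scale1 : left_id 1 kmod_scale.
Proof. by move=> m; rewrite /kmod_scale scale1r ract1. Qed.
Fact kmod_scaleDr : right_distributive kmod_scale +%R.
Proof. by move=> c m m'; rewrite /kmod_scale ractDl. Qed.
Fact kmod_scaleDl m : {morph kmod_scale^~ m : c c' / c + c'}.
Proof. by move=> c c'; rewrite /kmod_scale scalerDl ractDr. Qed.
HB.instance Definition _ := GRing.Zmodule_isLmodule.Build k kmod
  kmod_scaleA kmod_scale1 kmod_scaleDr kmod_scaleDl.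

Lemma ractZ (c : k) (m : M) (a : A) : m ** (c *: a) = c *: (m ** a : kmod).
Proof. by rewrite /GRing.scale /= /kmod_scale ractA mulr_algr. Qed.

Lemma kmodZ_ract (c : k) (m : kmod) (a : A) :
  (c *: m : M) ** a = c *: ((m : M) ** a : kmod).
Proof. by rewrite -ractZ /GRing.scale /= /kmod_scale ractA mulr_algl. Qed.

End Restriction.

Lemma fin_gen_onto (R : nzRingType) (V W : lmodType R) (f : {linear V -> W}) :
  (forall w, exists v, f v = w) -> fin_gen V -> fin_gen W.
Proof.
move=> surj [n [g Hg]]; exists n, (f \o g) => w.
have [v <-] := surj w; have [c ->] := Hg v; exists c.
by rewrite linear_sum; apply: eq_bigr => i _; rewrite linearZ.
Qed.

Lemma fin_gen_free (R : nzRingType) d : fin_gen ({ffun 'I_d -> R^o} : lmodType R).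
Proof.
exists d, (fun i => [ffun j => (j == i)%:R]) => c; exists c; apply/ffunP=> j.
rewrite sum_ffunE (bigD1 j) //= big1 => [|i /negPf ni].
  by rewrite !ffunE eqxx addr0 /GRing.scale /= mulr1.
by rewrite !ffunE eq_sym ni scaler0.
Qed.

Section FiniteDimension.
Variables (k : fieldType) (A : algType k).
Hypothesis fgA : fin_gen (A : lmodType k).

Lemma fin_gen_kmod (M : rmodType A) : fin_gen M -> fin_gen (kmod M).
Proof.
move=> [n [g Hg]]; case: fgA => r [u Hu].
exists #|{: 'I_n * 'I_r}|,
  (fun p => let q : 'I_n * 'I_r := enum_val p in g q.1 ** u q.2 : kmod M) => x.
have [c ->] := Hg x; have /choice[e He] : forall i, exists e : 'I_r -> k,
  (c i : A) = \sum_j e j *: u j by move=> i; apply: Hu.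
exists (fun p => let q : 'I_n * 'I_r := enum_val p in e q.1 q.2).
transitivity (\sum_(q : 'I_n * 'I_r) e q.1 q.2 *: (g q.1 ** u q.2 : kmod M)).
  rewrite -(pair_bigA _ (fun i j => e i j *: (g i ** u j : kmod M))) /=.
  apply: eq_bigr => i _; rewrite -/(ract (g i) (c i)) (He i) ract_sumr.
  by apply: eq_bigr => j _; rewrite ractZ.
rewrite (reindex (@enum_val ('I_n * 'I_r)%type predT)) //=.
exact/onW_bij/enum_val_bij.
Qed.

Lemma kmod_fin_gen (M : rmodType A) : fin_gen (kmod M) -> fin_gen M.
Proof.
move=> [n [g Hg]]; exists n, g => x; have [c Hc] := Hg x.
by exists (fun i => (c i)%:A : A).
Qed.
End FiniteDimension.

(** * Covers defined by a tensor *)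

Section TensorCover.
Variables (k : fieldType) (A : algType k) (I : finType) (a b : I -> A).
Hypothesis fgA : fin_gen (A : lmodType k).

(* The tensor \sum_i a_i (x) b_i of A (x)_k A commutes with y. *)
Definition balanced_at (y : A) : Prop := forall l : {linear A -> k^o},
  \sum_i l (y * a i) *: b i = \sum_i l (a i) *: (b i * y).

Hypothesis ab1 : \sum_i a i * b i = 1.
Hypothesis a_bal : forall i, balanced_at (a i).

Section Module.
Variables (M : rmodType A) (d : nat) (bs : 'I_d -> M).
Variable co : {linear kmod M -> 'rV[k]_d}.
Hypothesis coE : forall v : kmod M, v = \sum_i co v 0 i *: (bs i : kmod M).

(** [F] stands for M (x)_k A in coordinates, [tens m x] for m (x) x and [mu] for the action map.
    [Phi m] is the sum of the m a_j (x) b_j, and [phi] sends m (x) x to [Phi m ** x]. *)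
Let F : rmodType A := {ffun 'I_d -> (A^c)^o}.

Let tens (m : M) (x : A) : F := [ffun i => co m 0 i *: x].
Let Phi (m : M) : F := \sum_j tens (m ** a j) (b j).
Let mu (x : F) : M := \sum_i bs i ** x i.
Let phi (x : F) : F := \sum_i Phi (bs i) ** x i.

Let FE (x : F) (y : A) i : ((x ** y) i : A) = (x i : A) * y.
Proof. by rewrite ffunE. Qed.

Fact mu_linear : linear mu.
Proof.
move=> y u v; rewrite /mu scaler_sumr -big_split.
by apply: eq_bigr => i _ /=; rewrite !ffunE ractDr /ract scalerA.
Qed.
HB.instance Definition _ := GRing.isLinear.Build A^c F M _ mu mu_linear.

Fact phi_linear : linear phi.
Proof.
move=> y u v; rewrite /phi scaler_sumr -big_split.
by apply: eq_bigr => i _ /=; rewrite !ffunE ractDr /ract scalerA.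
Qed.
HB.instance Definition _ := GRing.isLinear.Build A^c F F _ phi phi_linear.

Let PhiE m i : Phi m i = \sum_j co (m ** a j) 0 i *: b j.
Proof. by rewrite sum_ffunE; apply: eq_bigr => j _; rewrite ffunE. Qed.

Fact Phi_linear : linear (Phi : kmod M -> kmod F).
Proof.
move=> c u v; apply/ffunP=> i; rewrite [LHS]PhiE [RHS]ffunE.
have -> : (c *: (Phi u : kmod F)) i = c *: (Phi u i : A).
  by rewrite [LHS]FE mulr_algr.
rewrite !PhiE scaler_sumr -big_split; apply: eq_bigr => j _ /=.
by rewrite ractDl kmodZ_ract linearP !mxE scalerDl scalerA.
Qed.
HB.instance Definition _ :=
  GRing.isLinear.Build k (kmod M) (kmod F) _ (Phi : kmod M -> kmod F) Phi_linear.

Let Phi0 : Phi 0 = 0. Proof. exact: (raddf0 (Phi : {linear kmod M -> kmod F})). Qed.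
Let PhiD u v : Phi (u + v) = Phi u + Phi v.
Proof. exact: (raddfD (Phi : {linear kmod M -> kmod F})). Qed.

Let PhiZ c (u : kmod M) : Phi (c *: u) = c *: (Phi u : kmod F).
Proof. exact: (linearZ_LR (Phi : {linear kmod M -> kmod F})). Qed.

Let phi_tens m x : phi (tens m x) = Phi m ** x.
Proof.
transitivity (Phi (\sum_i co m 0 i *: (bs i : kmod M)) ** x); last by rewrite -coE.
rewrite (linear_sum (Phi : {linear kmod M -> kmod F})) ract_suml.
apply: eq_bigr => i _; rewrite ffunE.
transitivity ((co m 0 i *: (Phi (bs i) : kmod F) : F) ** x).
  by rewrite kmodZ_ract -ractZ.
by congr ract; rewrite -PhiZ.
Qed.

Let mu_tens m x : mu (tens m x) = m ** x.
Proof.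
transitivity ((\sum_i co m 0 i *: (bs i : kmod M)) ** x); last by rewrite -coE.
rewrite ract_suml; apply: eq_bigr => i _; rewrite ffunE.
by rewrite kmodZ_ract -ractZ.
Qed.

Lemma mu_Phi m : mu (Phi m) = m.
Proof.
rewrite linear_sum -[RHS]ract1 -ab1 ract_sumr.
by apply: eq_bigr => j _; rewrite /= mu_tens ractA.
Qed.

(** Balancedness is tested on the functionals taking u to the i-th coordinate of m u. *)
Lemma Phi_ract m y : balanced_at y -> Phi (m ** y) = Phi m ** y.
Proof.
move=> bal; apply/ffunP=> i; rewrite FE !PhiE mulr_suml.
pose l (u : A) : k^o := co (m ** u) 0 i.
have llin : linear l.
  by move=> c u v; rewrite /l ractDr ractZ linearP !mxE.
pose l' : {linear A -> k^o} := HB.pack l (GRing.isLinear.Build k A k^o _ l llin).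
transitivity (\sum_j l' (y * a j) *: b j).
  by apply: eq_bigr => j _; rewrite ractA.
by rewrite bal; apply: eq_bigr => j _; rewrite scalerAl.
Qed.

(** The a_j are themselves balanced, so they move out of [Phi], and the sum of the a_j b_j is 1.
    This makes [phi] a projector. *)
Lemma phi_Phi m : phi (Phi m) = Phi m.
Proof.
rewrite [in LHS]/Phi linear_sum -[RHS]ract1 -ab1 ract_sumr.
by apply: eq_bigr => j _; rewrite /= phi_tens Phi_ract // ractA.
Qed.

Lemma phi_idem x : phi (phi x) = phi x.
Proof.
rewrite {2}/phi linear_sum; apply: eq_bigr => i _.
by rewrite linear_ract /= phi_Phi.
Qed.

Lemma mu_phi x : mu (phi x) = mu x.
Proof.
rewrite linear_sum; apply: eq_bigr => i _.
by rewrite linear_ract /= mu_Phi.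
Qed.

(** The model of M (x)_T A, with T the balanced elements: the image of the idempotent [phi], hence a
    direct summand of a free module. *)
Definition tc_mod : rmodType A := submodule (linfix phi).
Definition tc_map : {linear tc_mod -> M} := (mu \o val)%FUN.

Let tc_fixP (x : tc_mod) : phi (val x) = val x.
Proof. by apply/eqP; have := valP x; rewrite inE. Qed.

Fact tc_proj_subproof x : phi x \in linfix phi.
Proof. by rewrite inE /= phi_idem. Qed.
Let tc_proj (x : F) : tc_mod := Submodule (tc_proj_subproof x).
Fact tc_proj_linear : linear tc_proj.
Proof. by move=> y u v; apply: val_inj; rewrite /= linearP. Qed.
HB.instance Definition _ := GRing.isLinear.Build A^c F tc_mod _ tc_proj tc_proj_linear.

Let tc_projK : cancel (val : tc_mod -> F) tc_proj.
Proof. by move=> x; apply: val_inj; rewrite /= tc_fixP. Qed.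

Lemma tc_projective : projective tc_mod.
Proof.
exact: (projective_retract (i := (val : {linear tc_mod -> F}))
  (r := (tc_proj : {linear F -> tc_mod})) tc_projK (@projective_free A^c d)).
Qed.

Lemma tc_fin_gen : fin_gen tc_mod.
Proof.
apply: (fin_gen_onto (f := (tc_proj : {linear F -> tc_mod}))) (fin_gen_free _ _).
by move=> x; exists (val x); apply: tc_projK.
Qed.

Lemma tc_surj m : exists x, tc_map x = m.
Proof.
have fixP : Phi m \in linfix phi by rewrite inE /= phi_Phi.
by exists (Submodule fixP); rewrite /= mu_Phi.
Qed.

Lemma tc_zero : (forall m : M, m = 0) -> forall x : tc_mod, x = 0.
Proof.
move=> M0 x; apply: val_inj; rewrite -tc_fixP /phi big1 // => i _.
by rewrite (M0 (bs i)) Phi0 r0act.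
Qed.

Let kerP (x : submodule (linker tc_map)) : mu (val (val x)) = 0.
Proof. by apply/eqP; have := valP x; rewrite inE. Qed.

(* The k-linear projector phi - Phi mu maps F onto the kernel. *)
Lemma tc_ker_fin_gen : fin_gen (submodule (linker tc_map)).
Proof.
pose K : rmodType A := submodule (linker tc_map).
apply: kmod_fin_gen.
have fixP x : phi x - Phi (mu x) \in linfix phi.
  by rewrite inE linearB /= phi_idem phi_Phi.
have kerP' x : Submodule (fixP x) \in linker tc_map.
  by rewrite inE /= linearB /= mu_phi mu_Phi subrr.
pose psi (x : kmod F) : kmod K := Submodule (kerP' x).
have psi_lin : linear psi.
  move=> c u v; apply: val_inj; apply: val_inj; rewrite /=.
  have -> : phi (c *: u + v) = (c *: (phi u : kmod F) + phi v : kmod F).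
    by rewrite linearD linear_ract.
  have -> : mu (c *: u + v) = (c *: (mu u : kmod M) + mu v : kmod M).
    by rewrite linearD linear_ract.
  rewrite (linearP (Phi : {linear kmod M -> kmod F})) /=.
  by rewrite opprD addrACA -scalerBr.
pose psi' : {linear kmod F -> kmod K} :=
  HB.pack psi (GRing.isLinear.Build k (kmod F) (kmod K) _ psi psi_lin).
apply: (fin_gen_onto (f := psi')); last exact/fin_gen_kmod/fin_gen_free.
move=> x; exists (val (val x)); do 2 apply: val_inj.
by rewrite /= kerP Phi0 subr0 tc_fixP.
Qed.

(** Since M c = 0, the part [c * z] is annihilated on either side of [Phi], so [Phi] commutes with
    c' x c' as if that were balanced. For y in the kernel this gives y c' = Phi(mu(y) c') = 0. *)
Lemma tc_ker_killed (c c' : A) :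
  (forall m : M, m ** c = 0) -> balanced_at c ->
  (forall x, x * c' = c' * x * c') ->
  (forall x, exists2 y, balanced_at y & exists z, c' * x * c' = y + c * z) ->
  forall x : submodule (linker tc_map), x ** c' = 0.
Proof.
move=> Mc bal_c c'E split x; do 2 apply: val_inj.
pose y := val (val x); have y0 : mu y = 0 := kerP x.
have phiy : phi y = y by apply: tc_fixP.
change (y ** c' = 0); rewrite -phiy /phi ract_suml.
transitivity (\sum_i Phi (bs i ** ((y i : A) * c'))); last first.
  transitivity (Phi (mu y ** c')); last by rewrite y0 r0act Phi0.
  rewrite ract_suml (big_morph Phi PhiD Phi0).
  by apply: eq_bigr => i _; rewrite ractA.
apply: eq_bigr => i _; rewrite ractA [(y i : A) * c']c'E.
have [u bal_u [z ->]] := split (y i).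
rewrite !ractDr PhiD Phi_ract //; congr (_ + _).
by rewrite -!(@ractA A) -Phi_ract // Mc r0act Phi0 r0act.
Qed.

End Module.

Variable c : nat -> A.
Hypothesis bal_c : forall h, balanced_at (c h).
Hypothesis cE : forall h x, x * c h = c h * x * c h.
Hypothesis c_split : forall h x, exists2 y, balanced_at y &
  exists z, c h.+1 * x * c h.+1 = y + c h * z.

Definition killed_at h (M : rmodType A) : Prop :=
  fin_gen M /\ forall m : M, m ** c h = 0.

Definition killed_cover h (M : rmodType A) :
  killed_at h M -> proj_cover (killed_at h.+1) M.
Proof.
move=> [fgM Mc].
have /cid[d /cid[bs /cid[co coE]]] := fin_gen_coord (fin_gen_kmod fgA fgM).
apply: (ProjCover (cover_mod := tc_mod bs co) (cover_map := tc_map bs co)).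
- exact: tc_fin_gen.
- exact: tc_projective.
- exact: tc_surj.
- exact: tc_zero.
- by split; [apply: tc_ker_fin_gen | apply: tc_ker_killed (Mc) _ _ _].
Defined.

(** Every module is killed by [c 0 = 0], its h-th syzygy by [c h]; beyond degree d that is the unit,
    so the syzygy is zero. *)
Lemma gl_dim_le_tensor d : c 0 = 0 -> (forall h, (d < h)%N -> c h = 1) ->
  gl_dim_le A d.
Proof.
move=> c0 c1 M fgM; apply: (resolution (H := killed_at) killed_cover).
  by move=> h N [_ Nc] dh x; have := Nc x; rewrite c1 // ract1.
by split=> // m; rewrite c0 ract0.
Qed.
End TensorCover.

(** * Green's relations *)

Section GreenRelations.
Variable S : finMonoidType.
Implicit Types (s t u v w e x y : S).
Local Open Scope group_scope.

Lemma leRP s t : reflect (exists x, s = t * x) (leR s t).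
Proof.
apply: (iffP subsetP) => [/(_ s) | [x ->] _ /imsetP[y _ ->]].
  move=> Rs; have /Rs/imsetP[x _ ->] : s \in idealR s.
    by apply/imsetP; exists 1; rewrite ?mulg1.
  by exists x.
by rewrite -mulgA; apply: imset_f.
Qed.

Lemma leLP s t : reflect (exists x, s = x * t) (leL s t).
Proof.
apply: (iffP subsetP) => [/(_ s) | [x ->] _ /imsetP[y _ ->]].
  move=> Ls; have /Ls/imsetP[x _ ->] : s \in idealL s.
    by apply/imsetP; exists 1; rewrite ?mul1g.
  by exists x.
by rewrite mulgA; apply: (imset_f (fun x => x * t)).
Qed.

Lemma in_Rclass s t : (t \in Rclass s) = (idealR t == idealR s).
Proof. by rewrite inE eqEsubset. Qed.
Lemma in_Lclass s t : (t \in Lclass s) = (idealL t == idealL s).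
Proof. by rewrite inE eqEsubset. Qed.
Lemma in_Jclass s t : (t \in Jclass s) = (idealJ t == idealJ s).
Proof. by rewrite inE eqEsubset. Qed.

Lemma eqR_le s t : idealR s = idealR t -> leR s t.
Proof. by rewrite /leR => ->. Qed.
Lemma eqL_le s t : idealL s = idealL t -> leL s t.
Proof. by rewrite /leL => ->. Qed.
Lemma eqJ_le s t : idealJ s = idealJ t -> leJ s t.
Proof. by rewrite /leJ => ->. Qed.

Lemma leJxx s : leJ s s. Proof. exact: subxx. Qed.
Lemma leJ_trans t s u : leJ s t -> leJ t u -> leJ s u.
Proof. exact: subset_trans. Qed.
Lemma leJ_mulr s x : leJ (s * x) s.
Proof. by apply/leJP; exists 1, x; rewrite mul1g. Qed.
Lemma leJ_mull s x : leJ (x * s) s.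
Proof. by apply/leJP; exists x, 1; rewrite mulg1. Qed.
Lemma leJ_mul s x y : leJ (x * s * y) s.
Proof. by apply/leJP; exists x, y. Qed.
Lemma leR_leJ s t : leR s t -> leJ s t.
Proof. by move/leRP=> [x ->]; apply: leJ_mulr. Qed.
Lemma leL_leJ s t : leL s t -> leJ s t.
Proof. by move/leLP=> [x ->]; apply: leJ_mull. Qed.
Lemma eqR_eqJ s t : idealR s = idealR t -> idealJ s = idealJ t.
Proof.
by move=> st; apply/eqP; rewrite eqEsubset; apply/andP; split;
   apply/leR_leJ/eqR_le.
Qed.
Lemma eqL_eqJ s t : idealL s = idealL t -> idealJ s = idealJ t.
Proof.
by move=> st; apply/eqP; rewrite eqEsubset; apply/andP; split;
   apply/leL_leJ/eqL_le.
Qed.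

Lemma eqR_mull u s t : idealR s = idealR t -> idealR (u * s) = idealR (u * t).
Proof.
move=> st; have /leRP[x sE] := eqR_le st; have /leRP[y tE] := eqR_le (esym st).
apply/eqP; rewrite eqEsubset; apply/andP; split; apply/leRP.
  by exists x; rewrite {1}sE mulgA.
by exists y; rewrite {1}tE mulgA.
Qed.
Lemma eqL_mulr u s t : idealL s = idealL t -> idealL (s * u) = idealL (t * u).
Proof.
move=> st; have /leLP[x sE] := eqL_le st; have /leLP[y tE] := eqL_le (esym st).
apply/eqP; rewrite eqEsubset; apply/andP; split; apply/leLP.
  by exists x; rewrite {1}sE mulgA.
by exists y; rewrite {1}tE mulgA.
Qed.

(* Stability: u = x(uv)y makes |uS| <= |uvyS| <= |uvS|, while uvS is a subset *)
(* of uS.                                                                     *)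
Lemma stableR u v : leJ u (u * v) -> idealR (u * v) = idealR u.
Proof.
move=> /leJP[x [y uE]]; apply/eqP; rewrite eqEcard; apply/andP; split.
  by apply/leRP; exists v.
apply: (@leq_trans #|idealR (u * v * y)|).
  have -> : idealR u = [set x * z | z in idealR (u * v * y)].
    rewrite {1}uE /idealR -imset_comp; apply: eq_imset => z /=.
    by rewrite !mulgA.
  exact: leq_imset_card.
by apply: subset_leq_card; apply/leRP; exists y.
Qed.

Lemma stableL u v : leJ v (u * v) -> idealL (u * v) = idealL v.
Proof.
move=> /leJP[x [y vE]]; apply/eqP; rewrite eqEcard; apply/andP; split.
  by apply/leLP; exists u.
apply: (@leq_trans #|idealL (x * (u * v))|).
  have -> : idealL v = [set z * y | z in idealL (x * (u * v))].
    rewrite {1}vE /idealL -imset_comp; apply: eq_imset => z /=.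
    by rewrite !mulgA.
  exact: leq_imset_card.
by apply: subset_leq_card; apply/leLP; exists x.
Qed.

Variable e : S.
Hypothesis ee : e * e = e.

Lemma leR_idem s : leR s e -> e * s = s.
Proof. by move=> /leRP[x ->]; rewrite mulgA ee. Qed.
Lemma leL_idem s : leL s e -> s * e = s.
Proof. by move=> /leLP[x ->]; rewrite -mulgA ee. Qed.

(** Writing s = x e y, the element x e serves: stability applies to it on both sides. *)
Lemma Lclass_rep s : idealJ s = idealJ e ->
  exists r, idealL r = idealL e /\ idealR r = idealR s.
Proof.
move=> sJe; have /leJP[x [y sE]] := eqJ_le sJe.
have sxe : leJ s (x * e) by rewrite sE leJ_mulr.
exists (x * e); split; first by apply: stableL; rewrite /leJ -sJe.
rewrite [in RHS]sE [RHS]stableR //.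
rewrite -sE; exact: leJ_trans (leJ_mull _ _) (eqJ_le (esym sJe)).
Qed.

(** For s in the L-class of e, left multiplication by [linv s] carries the R-class of s back to that
    of e, as in Green's lemma. The default is not reached for such s. *)
Definition linv s : S := odflt 1 [pick y | (y * s == e) && (e * y == y)].

Lemma linvP s : idealL s = idealL e -> linv s * s = e /\ e * linv s = linv s.
Proof.
move=> sLe; rewrite /linv; case: pickP => [y /andP[/eqP ? /eqP ?] //|no].
have /leLP[w eE] := eqL_le (esym sLe).
by have := no (e * w); rewrite -mulgA -eE mulgA ee !eqxx.
Qed.

Lemma mul_linv s u : idealL s = idealL e -> leR u s -> s * (linv s * u) = u.
Proof.
move=> sLe /leRP[x ->]; have [sE _] := linvP sLe.
by rewrite (mulgA (linv s)) sE mulgA leL_idem // eqL_le.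
Qed.

Lemma maxgroup_predE s :
  (s \in maxgroup_pred e) = (idealR s == idealR e) && (idealL s == idealL e).
Proof.
apply/idP/andP => [|[/eqP sRe /eqP sLe]].
  rewrite inE => /and3P[/eqP es /eqP se /existsP[y /and4P[_ _ /eqP sy /eqP ys]]].
  split; rewrite eqEsubset; apply/andP; split;
    [apply/leRP|apply/leRP|apply/leLP|apply/leLP].
  - by exists s.
  - by exists y.
  - by exists s.
  - by exists y.
have es := leR_idem (eqR_le sRe); have se := leL_idem (eqL_le sLe).
have /leRP[w eE] := eqR_le (esym sRe); have [ls el] := linvP sLe.
rewrite inE es se !eqxx /=; apply/existsP; exists (linv s * e).
apply/and4P; split; apply/eqP.
- by rewrite mulgA el.
- by rewrite -mulgA ee.
- by rewrite [in LHS]eE !mulgA -(mulgA s) ls se -eE.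
- by rewrite -mulgA es ls.
Qed.

Lemma Jclass_corner s : idealJ s = idealJ e -> e * s = s -> s * e = s ->
  idealR s = idealR e /\ idealL s = idealL e.
Proof.
move=> sJe es se; split.
  by rewrite -es; apply: stableR; rewrite es; apply: eqJ_le.
by rewrite -se; apply: stableL; rewrite se; apply: eqJ_le.
Qed.
End GreenRelations.

(** * Ideals of a monoid algebra *)

Section LinearExtension.
Variables (k : fieldType) (S : finMonoidType).
Local Notation kS := (monalgebra k S).
Local Notation be := (ma_basis k).

Lemma ma_decomp (x : kS) : x = \sum_s x s *: be s.
Proof.
apply/ffunP=> t; rewrite sum_ffunE (bigD1 t) //= big1 => [|s /negPf ns].
  by rewrite !ffunE eqxx addr0 /GRing.scale /= mulr1.
by rewrite !ffunE eq_sym ns scaler0.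
Qed.

Lemma fin_gen_monalgebra : fin_gen (kS : lmodType k).
Proof.
exists #|S|, (fun i => be (enum_val i)) => x; exists (fun i => x (enum_val i)).
rewrite {1}[x]ma_decomp (reindex (@enum_val S predT)) //=.
exact/onW_bij/enum_val_bij.
Qed.

Lemma ma_mul_basis (x : kS) s t : (x * be s) t = \sum_(w | (w * s)%g == t) x w.
Proof.
rewrite mulmaE [RHS]big_mkcond; apply: eq_bigr => w _.
rewrite (bigD1 s) //= big1 => [|u /negPf nu].
  by rewrite [X in _ * X * _]ffunE eqxx mulr1 addr0; case: eqP; rewrite ?mulr1 ?mulr0.
by rewrite [X in _ * X * _]ffunE nu mulr0 mul0r.
Qed.

Lemma ma_basis_mull (x : kS) s t : (be s * x) t = \sum_(w | (s * w)%g == t) x w.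
Proof.
rewrite mulmaE exchange_big [RHS]big_mkcond; apply: eq_bigr => w _ /=.
rewrite (bigD1 s) //= big1 => [|u /negPf nu].
  by rewrite ffunE eqxx mul1r addr0; case: eqP; rewrite ?mulr1 ?mulr0.
by rewrite ffunE nu !mul0r.
Qed.

Section Extend.
Variables (W : lmodType k) (g : S -> W).
Definition lin_ext (x : kS) : W := \sum_s x s *: g s.
Fact lin_ext_linear : linear lin_ext.
Proof.
move=> a x y; rewrite scaler_sumr -big_split; apply: eq_bigr => s _ /=.
by rewrite !ffunE scalerDl scalerA.
Qed.
HB.instance Definition _ :=
  GRing.isLinear.Build k kS W _ lin_ext lin_ext_linear.

Lemma lin_ext_basis s : lin_ext (be s) = g s.
Proof.
rewrite /lin_ext (bigD1 s) //= big1 => [|t /negPf nt].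
  by rewrite ffunE eqxx scale1r addr0.
by rewrite ffunE nt scale0r.
Qed.
End Extend.

Implicit Types (I : {set S}) (x y z a b : kS) (s t u v : S).

Definition ideal I := forall s u v, s \in I -> (u * s * v)%g \in I.

Lemma ideal_mull I s u : ideal I -> s \in I -> (u * s)%g \in I.
Proof. by move=> idI /(idI _ u 1%g); rewrite mulg1. Qed.
Lemma ideal_mulr I s v : ideal I -> s \in I -> (s * v)%g \in I.
Proof. by move=> idI /(idI _ 1%g v); rewrite mul1g. Qed.
Lemma ideal_leJ I s t : ideal I -> leJ t s -> s \in I -> t \in I.
Proof. by move=> idI /leJP[u [v ->]]; apply: idI. Qed.
Lemma Jdown_isideal s : ideal (Jdown s).
Proof. by move=> t u v; apply: Jdown_ideal. Qed.

Definition kspan I : {pred kS} := [pred x : kS | [forall s, (s \notin I) ==> (x s == 0)]].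

Lemma kspanP I x : reflect (forall s, s \notin I -> x s = 0) (x \in kspan I).
Proof. by apply: (iffP 'forall_implyP) => H s /H /eqP. Qed.

Fact kspan_submod I : submod_closed (kspan I).
Proof.
split=> [|a x y /kspanP Hx /kspanP Hy]; apply/kspanP=> s Is; rewrite !ffunE //.
by rewrite Hx // Hy // addr0 scaler0.
Qed.
HB.instance Definition _ I :=
  GRing.isSubmodClosed.Build k kS (kspan I) (kspan_submod I).

Lemma kspan_basis I s : (be s \in kspan I) = (s \in I).
Proof.
apply/kspanP/idP => [H|Is t It]; last first.
  by rewrite ffunE; case: eqP => // ts; rewrite ts Is in It.
by apply: contraT => /H /eqP; rewrite ffunE eqxx oner_eq0.
Qed.

Lemma kspan_sub I I' x : I \subset I' -> x \in kspan I -> x \in kspan I'.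
Proof.
by move=> /subsetP sub /kspanP Hx; apply/kspanP=> s /(contra (sub s)) /Hx.
Qed.

Lemma kspan_decomp I x : x \in kspan I -> x = \sum_(s in I) x s *: be s.
Proof.
move=> /kspanP Hx; rewrite {1}[x]ma_decomp [RHS]big_mkcond; apply: eq_bigr => s _.
by case: ifPn => // /Hx ->; rewrite scale0r.
Qed.

Lemma kspanT x : x \in kspan [set: S].
Proof. by apply/kspanP=> s; rewrite inE. Qed.

Lemma kspanMl I x a : ideal I -> x \in kspan I -> a * x \in kspan I.
Proof.
move=> idI /kspan_decomp ->; rewrite {1}[a]ma_decomp mulr_suml.
apply: rpred_sum => u _; rewrite mulr_sumr; apply: rpred_sum => s Is.
by rewrite -scalerAl -scalerAr ma_basisM !rpredZ // kspan_basis ideal_mull.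
Qed.

Lemma kspanMr I x a : ideal I -> x \in kspan I -> x * a \in kspan I.
Proof.
move=> idI /kspan_decomp ->; rewrite {1}[a]ma_decomp mulr_suml.
apply: rpred_sum => s Is; rewrite mulr_sumr; apply: rpred_sum => u _.
by rewrite -scalerAl -scalerAr ma_basisM !rpredZ // kspan_basis ideal_mulr.
Qed.

Lemma lin_ext_ract I I' (g : S -> kS) :
  (forall u v, u \in I -> g (u * v)%g - g u * be v \in kspan I') ->
  forall x y, x \in kspan I -> lin_ext g (x * y) - lin_ext g x * y \in kspan I'.
Proof.
move=> gI x y /kspan_decomp ->; rewrite {1 2}[y]ma_decomp.
rewrite mulr_suml !linear_sum mulr_suml -sumrB; apply: rpred_sum => u Iu.
rewrite !mulr_sumr linear_sum -sumrB; apply: rpred_sum => v _.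
rewrite -!scalerAr -!scalerAl ma_basisM !linearZ /= !lin_ext_basis.
by rewrite -?scalerAl -scalerDr -scalerBr !rpredZ // gI.
Qed.

Lemma lin_ext_id I g x : {in I, forall s, g s = be s} -> x \in kspan I -> lin_ext g x = x.
Proof.
move=> gI xI; rewrite {1}(kspan_decomp xI) linear_sum [RHS](kspan_decomp xI).
by apply: eq_bigr => s Is; rewrite linearZ /= lin_ext_basis gI.
Qed.

Lemma lin_ext_mod I I' g h x :
  {in I, forall s, g s - h s \in kspan I'} -> x \in kspan I ->
  lin_ext g x - lin_ext h x \in kspan I'.
Proof.
move=> gI xI; rewrite (kspan_decomp xI) [lin_ext g _]linear_sum.
rewrite [lin_ext h _]linear_sum -sumrB.
apply: rpred_sum => s Is.
by rewrite !linearZ /= !lin_ext_basis -scalerDr rpredZ // gI.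
Qed.

Definition left_id_of I a := a \in kspan I /\ forall x, x \in kspan I -> a * x = x.

Lemma left_id_of_basis I a : a \in kspan I ->
  (forall s, s \in I -> a * be s = be s) -> left_id_of I a.
Proof.
move=> aI H; split=> // x /kspan_decomp ->; rewrite mulr_sumr.
by apply: eq_bigr => s Is; rewrite -scalerAr H.
Qed.

Definition has_left_id I := exists a, left_id_of I a.

End LinearExtension.

(** * Left identities of ideals *)

Section LeftIdentities.
Variables (k : fieldType) (S : finMonoidType).
Local Notation kS := (monalgebra k S).
Local Notation be := (ma_basis k).
Implicit Types (I : {set S}) (x y z a b : kS) (s t u v : S).

Lemma Jdown_eqJ s t : idealJ s = idealJ t -> Jdown s = Jdown t.
Proof. by move=> st; apply/setP=> u; rewrite !inE /leJ st. Qed.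

Lemma JdownE s t : (t \in Jdown s) = leJ t s && (idealJ t != idealJ s).
Proof. by rewrite inE /leJ eqEsubset negb_and; case: (_ \subset _). Qed.

Lemma leJ_Jdown s t : leJ t s -> t \notin Jclass s -> t \in Jdown s.
Proof. by rewrite JdownE in_Jclass => -> ->. Qed.

Lemma kspan0 x : x \in kspan set0 -> x = 0.
Proof. by move=> /kspanP x0; apply/ffunP=> s; rewrite x0 ?inE // ffunE. Qed.

Lemma ideal_adjoin I s : ideal I -> Jdown s \subset I -> ideal (I :|: Jclass s).
Proof.
move=> idI /subsetP JI t u v; rewrite !in_setU => /orP[tI|]; first by rewrite idI.
rewrite inE => /andP[ts _].
have uvs : leJ (u * t * v)%g s by apply: leJ_trans (leJ_mul _ _ _) ts.
rewrite [_ \in Jclass s]inE uvs /=; case: (boolP (leJ s _)) => [_|nsu]; first by rewrite orbT.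
by rewrite orbF JI // inE uvs.
Qed.

Definition split_idem (e : S) := exists2 eps : kS,
  forall x, x \in kspan (Jdown e) -> eps * x = 0
  & eps - be e \in kspan (Jdown e).

(* Removing a minimal J-class J from an ideal with a left identity: mapping   *)
(* u in J to u - r eps r' u, where r r' u = u and r' r = e, extends the       *)
(* identity of the smaller ideal to a right linear retraction.                *)
Lemma left_id_remove I (e s : S) : (e * e)%g = e -> idealJ s = idealJ e ->
  split_idem e -> ideal I -> s \notin I -> Jdown s \subset I ->
  has_left_id k (I :|: Jclass s) -> has_left_id k I.
Proof.
move=> ee sJe [eps epsJ epse] idI sI JI [eta [etaI etaE]].
have JeI : Jdown e \subset I by rewrite -(Jdown_eqJ sJe).
pose r u := odflt 1%g [pick r | (idealL r == idealL e) && (idealR r == idealR u)].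
have rP u : u \in Jclass s -> idealL (r u) = idealL e /\ idealR (r u) = idealR u.
  rewrite in_Jclass sJe => /eqP uJe; rewrite /r.
  case: pickP => [w /andP[/eqP ? /eqP ?] //|no].
  have [w [wL wR]] := Lclass_rep uJe.
  by have := no w; rewrite wL wR !eqxx.
(* The representative depends on the R-class alone, so right multiplication inside J does not change
   it; hence [g] is right linear there. *)
have rR u v : idealR u = idealR v -> r u = r v by rewrite /r => ->.
pose g u := be (r u) * eps * be (linv e (r u) * u)%g.
pose tau u := if u \in Jclass s then be u - g u else be u.
have tauI u : u \in I :|: Jclass s -> tau u \in kspan I.
  rewrite /tau in_setU; case: ifPn => [uJ _|uJ]; last by rewrite orbF kspan_basis.
  have [rL rRu] := rP _ uJ.
  have -> : be u - g u = be (r u) * (be e - eps) * be (linv e (r u) * u)%g.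
    rewrite mulrBr mulrBl !ma_basisM (leL_idem ee (eqL_le rL)).
    by rewrite (mul_linv ee rL (eqR_le (esym rRu))).
  rewrite kspanMr ?kspanMl //; apply: kspan_sub JeI _.
  by rewrite -rpredN opprB.
have tau_ract u v : u \in I :|: Jclass s ->
    tau (u * v)%g - tau u * be v \in kspan set0.
  move=> uIJ; suff -> : tau (u * v)%g = tau u * be v by rewrite subrr rpred0.
  rewrite /tau; case: ifPn => [uvJ|uvJ]; case: ifPn => [uJ|uJ].
  - have uR : idealR (u * v)%g = idealR u.
      apply: stableR; apply: eqJ_le; move: uvJ uJ; rewrite !in_Jclass.
      by move=> /eqP -> /eqP ->.
    by rewrite /g (rR _ _ uR) mulrBl ma_basisM -!mulrA ma_basisM !mulgA.
  - case/negP: sI; move: uIJ; rewrite in_setU (negPf uJ) orbF.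
    by apply: ideal_leJ => //; move: uvJ; rewrite inE => /andP[_ /leJ_trans->] //; apply: leJ_mulr.
  (* Here u v has dropped below J, and [eps] kills the correction term. *)
  - rewrite mulrBl ma_basisM /g -!mulrA ma_basisM epsJ ?mulr0 ?subr0 // kspan_basis.
    rewrite -mulgA ideal_mull //; first exact: Jdown_isideal.
    rewrite -(Jdown_eqJ sJe) leJ_Jdown //; apply: leJ_trans (leJ_mulr _ _) _.
    by move: uJ; rewrite inE => /andP[].
  - by rewrite ma_basisM.
exists (lin_ext tau eta); split.
  rewrite (kspan_decomp etaI) linear_sum; apply: rpred_sum => u uIJ.
  by rewrite linearZ /= lin_ext_basis rpredZ // tauI.
move=> x xI; have := lin_ext_ract tau_ract x etaI.
rewrite etaE; last by apply: kspan_sub xI; apply: subsetUl.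
move=> /kspan0/eqP; rewrite subr_eq0 => /eqP <-; apply: lin_ext_id xI => u uI.
rewrite /tau ifN //; apply: contra sI; rewrite inE => /andP[_ su].
exact: ideal_leJ su uI.
Qed.

(** Induction on the complement of I, starting from S with left identity 1. A J-class minimal
    outside I, found by the size of its principal ideal, is adjoined, and [left_id_remove] takes it
    away again. *)
Lemma left_id_of_split :
  (forall s, exists e : S,
     [/\ (e * e)%g = e, idealJ s = idealJ e & split_idem e]) ->
  forall I, ideal I -> has_left_id k I.
Proof.
move=> split I; have [n] := ubnP #|~: I|; elim: n I => // n IHn I leIn idI.
case: (pickP [in ~: I]) => [s0 /= s0I|I0]; last first.
  have -> : I = [set: S].
    by apply/setP=> s; have := I0 s; rewrite !inE => /negbFE ->.
  by exists 1; split=> [|x _]; [apply: kspanT | rewrite mul1r].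
case: (arg_minnP (fun s => #|idealJ s|) s0I) => s /= sI min_s.
have {}sI : s \notin I by rewrite -in_setC.
have [e [ee sJe es]] := split s.
have JI : Jdown s \subset I.
  apply/subsetP=> t; rewrite inE => /andP[ts nst]; apply: contraT => tI.
  have /min_s : t \in ~: I by rewrite inE.
  by rewrite leqNgt proper_card //; apply/andP.
apply: (left_id_remove ee sJe es idI _ JI); first by [].
apply: IHn; last exact: ideal_adjoin.
rewrite -ltnS; apply: leq_trans leIn; rewrite ltnS proper_card // properEneq.
rewrite setCS subsetUl andbT; apply/eqP=> /setP/(_ s).
by rewrite !inE (negPf sI) !leJxx.
Qed.

Definition local_left_id (e : S) := exists2 theta : kS,
  theta \in kspan [set t | leJ t e]
  & forall t, t \in Jclass e -> theta * be t - be t \in kspan (Jdown e).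

(** Induction on I, removing a maximal J-class to get I'. In 1 - eta = (1 - eta')(1 - theta), the
    factor 1 - theta maps kI into kI', where 1 - eta' vanishes. *)
Lemma left_id_of_local :
  (forall s, exists2 e, idealJ s = idealJ e & local_left_id e) ->
  forall I, ideal I -> has_left_id k I.
Proof.
move=> loc I; have [n] := ubnP #|I|; elim: n I => // n IHn I leIn idI.
case: (pickP [in I]) => [s0 /= s0I|I0]; last first.
  exists 0; split=> [|x]; first exact: rpred0.
  have -> : I = set0 by apply/setP=> s; rewrite I0 inE.
  by move/kspan0->; rewrite mulr0.
case: (arg_maxnP (fun s => #|idealJ s|) s0I) => s sI max_s.
have [e sJe [theta thetaJ thetaE]] := loc s.
pose I' := I :\: Jclass s.
have idI' : ideal I'.
  move=> t u v; rewrite !in_setD => /andP[tJ tI]; rewrite idI // andbT.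
  apply: contra tJ; rewrite !inE => /andP[_ su].
  have st := leJ_trans su (leJ_mul _ _ _).
  by rewrite st andbT; apply: contraT => nts; have := max_s t tI;
    rewrite /= leqNgt proper_card //; apply/andP.
have ltI' : (#|I'| < n)%N.
  rewrite -ltnS; apply: leq_trans leIn; rewrite ltnS proper_card // properEneq.
  rewrite subsetDl andbT; apply/eqP=> /setP/(_ s).
  by rewrite !inE [s \in I]sI !leJxx.
have [eta' [eta'I eta'E]] := IHn I' ltI' idI'.
have JeE : Jclass e = Jclass s by apply/setP=> t; rewrite !in_Jclass sJe.
have JI : [set t | leJ t e] \subset I.
  apply/subsetP=> t; rewrite inE => te; apply: ideal_leJ sI => //.
  exact: leJ_trans te (eqJ_le (esym sJe)).
have JI' : Jdown e \subset I'.
  rewrite -(Jdown_eqJ sJe); apply/subsetP=> t; rewrite !inE => /andP[ts nst].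
  by rewrite ts (negPf nst) (ideal_leJ idI ts sI).
have I'I : I' \subset I := subsetDl _ _.
have thetaI := kspan_sub JI thetaJ.
exists (eta' + theta - eta' * theta); apply: left_id_of_basis => [|t tI].
  by rewrite rpredB ?rpredD ?(kspan_sub I'I eta'I) ?kspanMl.
have : theta * be t - be t \in kspan I'.
  have [tJ|tJ] := boolP (t \in Jclass s).
    by apply: (kspan_sub JI'); rewrite thetaE // JeE.
  have tI' : be t \in kspan I' by rewrite kspan_basis inE tJ.
  by rewrite rpredB ?kspanMl.
move/eta'E; rewrite mulrBr => H; rewrite mulrBl mulrDl -mulrA.
move/eqP: H; rewrite subr_eq => /eqP ->; apply/eqP.
by rewrite subr_eq addrA [be t + _]addrC subrK addrC.
Qed.

Section Coefficients.
Variables (I I' : {set S}) (e : S) (eta : kS).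
Hypotheses (idI : ideal I) (idI' : ideal I') (ee : (e * e)%g = e).
Hypothesis sep : forall u v, u \in I -> (u * v)%g \notin I' ->
  idealR (u * v)%g = idealR u.
Hypothesis etaP : left_id_of I eta.

Definition Rcoef s u : kS :=
  if idealR u == idealR s then be (linv e s * u)%g else 0.

Lemma Rcoef_ract s x y : x \in kspan I ->
  lin_ext (Rcoef s) (x * y) - lin_ext (Rcoef s) x * y \in kspan I'.
Proof.
apply: lin_ext_ract => u v uI; rewrite /Rcoef.
have [uvI|uvI] := boolP ((u * v)%g \in I'); last first.
  by rewrite (sep uI uvI); case: ifP => _; rewrite ?mul0r ?ma_basisM ?mulgA subrr ?rpred0.
apply: rpredB.
  by case: ifP => _; rewrite ?rpred0 // kspan_basis ideal_mull.
case: ifP => _; rewrite ?mul0r ?rpred0 // ma_basisM.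
by rewrite kspan_basis -mulgA ideal_mull.
Qed.

(* Taking the component in one R-class is right linear modulo I', hence is    *)
(* left multiplication by its value at the left identity.                     *)
Lemma Rcoef_left_id s x : x \in kspan I ->
  lin_ext (Rcoef s) eta * x - lin_ext (Rcoef s) x \in kspan I'.
Proof.
move=> xI; have [etaI etaE] := etaP.
rewrite -[in X in _ - X](etaE _ xI) -opprB rpredN.
exact: Rcoef_ract.
Qed.
End Coefficients.

End LeftIdentities.

(** * The level filtration *)

Section Levels.
Variable S : finMonoidType.

(* s is in level h iff chains of J-classes with top J_s have length at most h. *)
Fixpoint level h : {set S} :=
  if h is h'.+1 then [set s | Jdown s \subset level h'] else set0.

Lemma ideal_level h : ideal (level h).
Proof.
case: h => [|h] s u v; first by rewrite inE.
rewrite !inE => /subsetP sI; apply/subsetP=> t; rewrite inE => /andP[tu nt].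
have us := leJ_mul s u v.
apply: sI; rewrite inE (leJ_trans tu us) /=.
by apply: contra nt; apply: leJ_trans.
Qed.

Lemma level_subS h : level h \subset level h.+1.
Proof.
elim: h => [|h IHh]; first exact: sub0set.
by apply/subsetP=> s; rewrite !inE => sI; apply: subset_trans IHh.
Qed.

Lemma level_sub h j : (h <= j)%N -> level h \subset level j.
Proof.
move=> /subnK <-; elim: (j - h)%N => // m IHm.
by rewrite addSn; apply: subset_trans (level_subS _).
Qed.

Lemma level_leJ h s t :
  s \in level h.+1 -> leJ t s -> t \notin level h -> leJ s t.
Proof.
rewrite inE => /subsetP sI ts tI; apply: contraT => nst.
by rewrite sI ?inE ?ts in tI.
Qed.

Lemma level_stableR h u v :
  u \in level h.+1 -> (u * v)%g \notin level h -> idealR (u * v)%g = idealR u.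
Proof. by move=> uI uvI; apply/stableR/(level_leJ uI) => //; apply: leJ_mulr. Qed.
Lemma level_stableL h u v :
  v \in level h.+1 -> (u * v)%g \notin level h -> idealL (u * v)%g = idealL v.
Proof. by move=> vI uvI; apply/stableL/(level_leJ vI) => //; apply: leJ_mull. Qed.

End Levels.

Section NestedIdentities.
Variables (k : fieldType) (S : finMonoidType).
Local Notation kS := (monalgebra k S).
Local Notation level := (@level S).
Variable N : nat.
Hypothesis levN : level N = [set: S].

(** With arbitrary left identities eta_h, set c_h = eta_h c_(h+1), going down from 1. As c_(h+1) is
    idempotent, c_h c_(h+1) = c_h. *)
Lemma nested_left_ids : (forall I : {set S}, ideal I -> has_left_id k I) ->
  exists c : nat -> kS, [/\ forall h, left_id_of (level h) (c h),
    forall h, c h * c h.+1 = c h & forall h, (N <= h)%N -> c h = 1].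
Proof.
move=> lid; have /choice[eta etaP] := fun h => lid _ (@ideal_level S h).
(* The recursion counts levels from the top: this [c d] belongs to level [N - d]. *)
pose c := fix c d := if d is d'.+1 then eta (N - d)%N * c d' : kS else 1.
have levT h : (N <= h)%N -> level h = [set: S].
  by move=> Nh; apply/eqP; rewrite -subTset -levN level_sub.
have c1 h : (N <= h)%N -> c (N - h)%N = 1 by rewrite -subn_eq0 => /eqP ->.
have cS h : (h < N)%N -> c (N - h)%N = eta h * c (N - h.+1)%N.
  by move=> hN; rewrite -(subnSK hN) /= subnSK // subKn // ltnW.
have cP h : left_id_of (level h) (c (N - h)%N).
  have [m] := ubnP (N - h)%N; elim: m h => // m IHm h; rewrite ltnS => hm.
  have [Nh|hN] := leqP N h.
    by rewrite c1 // levT //; split=> [|x _]; [apply: kspanT | apply: mul1r].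
  rewrite cS //; have [etaI etaE] := etaP h.
  have [|_ cE] := IHm h.+1.
    by apply: leq_trans hm; rewrite subnS prednK ?subn_gt0.
  split; first by apply: kspanMr => //; apply: ideal_level.
  move=> x xI; rewrite -mulrA cE ?etaE //.
  exact: kspan_sub (level_subS _ _) xI.
exists (fun h => c (N - h)%N); split=> // h.
have [Nh|hN] := leqP N h; first by rewrite !c1 ?mul1r // leqW.
have [cI cE] := cP h.+1.
by rewrite cS // -mulrA cE.
Qed.

Variable c : nat -> kS.
Hypotheses (cP : forall h, left_id_of (level h) (c h))
  (cS : forall h, c h * c h.+1 = c h) (c1 : forall h, (N <= h)%N -> c h = 1).

Lemma c_span h : c h \in kspan (level h). Proof. by case: (cP h). Qed.
Lemma c_id h x : x \in kspan (level h) -> c h * x = x.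
Proof. by case: (cP h) => _; apply. Qed.

Lemma c_span_le h j : (h <= j)%N -> c h \in kspan (level j).
Proof. by move=> hj; apply: kspan_sub (level_sub _ hj) (c_span h). Qed.

Lemma c_mul_ge h j : (j <= h)%N -> c h * c j = c j.
Proof. by move=> jh; rewrite c_id // c_span_le. Qed.

Lemma c_mul_le h j : (h <= j)%N -> c h * c j = c h.
Proof.
move=> /subnK <-; elim: (j - h)%N => [|m IHm]; first by rewrite c_mul_ge.
by rewrite addSn -{1}IHm -mulrA cS IHm.
Qed.

Definition diag h := c h.+1 - c h.

Lemma diag_kill h x : x \in kspan (level h) -> diag h * x = 0.
Proof.
move=> xI; rewrite mulrBl !c_id ?subrr //.
exact: kspan_sub (level_subS _ _) xI.
Qed.

Lemma diag_eq h x y : x - y \in kspan (level h) -> diag h * x = diag h * y.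
Proof. by move/diag_kill; rewrite mulrBr => /eqP; rewrite subr_eq0 => /eqP. Qed.

Lemma c_mulC h j : c h * c j = c j * c h.
Proof. by case/orP: (leq_total h j) => hj; rewrite (c_mul_le hj) (c_mul_ge hj). Qed.

Lemma c_diag j h : c j * diag h = diag h * c j.
Proof. by rewrite mulrBr mulrBl !(c_mulC j). Qed.

Lemma diag_c_le h j : (j <= h)%N -> diag h * c j = 0.
Proof. by move=> jh; rewrite diag_kill // c_span_le. Qed.

Lemma diag_c_gt h j : (h < j)%N -> diag h * c j = diag h.
Proof. by move=> hj; rewrite mulrBl !c_mul_le // ltnW. Qed.

Lemma diag_diag h x y : y \in kspan (level h.+1) ->
  diag h * x * diag h * y = diag h * x * y.
Proof.
move=> yI; rewrite -[LHS]mulrA [diag h * y]mulrBl c_id // mulrBr.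
rewrite -[X in _ - X]mulrA [X in _ - X]diag_kill ?subr0 //.
have idh := @ideal_level S h.
by rewrite kspanMl // kspanMr // c_span.
Qed.

Lemma sum_diag : \sum_(h < N) diag h = 1.
Proof.
rewrite -(big_mkord xpredT diag) telescope_sumr // c1 //.
have -> : c 0 = 0 by apply: kspan0; apply: c_span 0.
by rewrite subr0.
Qed.

(** Membership in T, the block diagonal subalgebra: the sum of the corners cut out by the orthogonal
    idempotents [diag h]. *)
Definition diagonal (y : kS) := forall h, c h * y = y * c h.

Lemma diagonal_corner h x : diagonal (diag h * x * diag h).
Proof.
move=> j; rewrite !mulrA c_diag -[RHS]mulrA; have [jh|hj] := leqP j h.
  by rewrite diag_c_le // !mul0r mulr0.
by rewrite diag_c_gt.
Qed.

Lemma diagonal_c h : diagonal (c h).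
Proof. by move=> j; rewrite c_mulC. Qed.

Lemma diagonal_diag y h : diagonal y -> y * diag h = diag h * y.
Proof. by move=> yT; rewrite mulrBr mulrBl !yT. Qed.

Lemma c_mulr h x : x * c h = c h * x * c h.
Proof.
by rewrite -mulrA c_id // kspanMl ?c_span //; apply: ideal_level.
Qed.

(** Triangularity: x c_h lies in the span of level h, which [diag h] kills, so one off-diagonal
    block is missing. *)
Lemma c_split h x : c h.+1 * x * c h.+1 =
  diag h * x * diag h + c h * (x * c h.+1).
Proof.
have idh := @ideal_level S h.
have -> : diag h * x * diag h = diag h * x * c h.+1.
  rewrite [in LHS]mulrBr -[X in _ - X]mulrA [X in _ - X]diag_kill ?subr0 //.
  by rewrite kspanMl // c_span.
by rewrite mulrA -!mulrDl subrK.
Qed.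

End NestedIdentities.

(** * The tensor of a J-class *)

Section HClasses.
Variables (S : finMonoidType) (e : S).
Hypothesis ee : (e * e)%g = e.
Local Open Scope group_scope.

Lemma mul_linv_R s u :
  idealL s = idealL e -> idealR u = idealR s -> s * (linv e s * u) = u.
Proof. by move=> sL uR; apply: mul_linv => //; apply: eqR_le. Qed.

Lemma linv_R s u :
  idealL s = idealL e -> idealR u = idealR s -> idealR (linv e s * u) = idealR e.
Proof.
by move=> sL uR; rewrite (eqR_mull (linv e s) uR); case: (linvP ee sL) => ->.
Qed.

Lemma linv_L s u :
  idealL s = idealL e -> idealR u = idealR s -> idealL (linv e s * u) = idealL u.
Proof.
move=> sL uR; apply/eqP; rewrite eqEsubset; apply/andP; split; apply/leLP.
  by exists (linv e s).
by exists s; rewrite mul_linv_R.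
Qed.

(* The groupoid of the L-class of e: for s, t in L_e with s R t, the element  *)
(* linv s * t of the maximal subgroup translates s to t.                      *)
Lemma linv_transl s t v (w := v * (linv e s * t)) :
  idealL s = idealL e -> idealL t = idealL e -> idealL v = idealL e ->
  idealR t = idealR s ->
  [/\ idealL w = idealL e, idealR w = idealR v, linv e v * w = linv e s * t,
      t * (linv e w * v) = s
    & forall z, (z * t == w) = (z * s == v)].
Proof.
move=> sL tL vL tR; set g := linv e s * t.
have gR : idealR g = idealR e by apply: linv_R.
have gL : idealL g = idealL e by rewrite linv_L.
have eg := leR_idem ee (eqR_le gR).
have ve := leL_idem ee (eqL_le vL).
have se := leL_idem ee (eqL_le sL).
have wL : idealL w = idealL e by rewrite (eqL_mulr g vL) eg.
have wR : idealR w = idealR v by rewrite (eqR_mull v gR) ve.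
have vw : linv e v * w = g by rewrite mulgA (proj1 (linvP ee vL)) eg.
have sg : s * g = t by apply: mul_linv_R.
have gg' : g * (linv e w * v) = e.
  by rewrite -vw -mulgA mul_linv_R // (proj1 (linvP ee vL)).
have tg' : t * (linv e w * v) = s by rewrite -sg -mulgA gg' se.
split=> // z; rewrite -sg mulgA; apply/eqP/eqP => [zw|-> //].
by rewrite -se mulgA -gg' mulgA zw -/g -mulgA gg' ve.
Qed.

(** By Green's lemma, left multiplication by a representative r of the R-class of u in the L-class
    of e maps the group bijectively onto this H-class. *)
Lemma card_HLclass u : idealJ u = idealJ e ->
  #|[set s in Lclass e | idealR u == idealR s]| = #|maxgroup_pred e|.
Proof.
move=> uJ; have [r [rL rR]] := Lclass_rep uJ.
have inj : {in [set g in maxgroup_pred e] &, injective (fun g => r * g)}.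
  move=> g g'; rewrite !inE => /and3P[/eqP eg _ _] /and3P[/eqP eg' _ _] rg.
  by rewrite -eg -eg' -(proj1 (linvP ee rL)) -!mulgA rg.
rewrite -[RHS]cardsE -[RHS](card_in_imset inj).
apply: eq_card => s; rewrite inE in_Lclass; apply/andP/imsetP.
  move=> [/eqP sL /eqP sR]; exists (linv e r * s); last first.
    by rewrite mul_linv_R // -sR.
  rewrite in_set (maxgroup_predE ee) linv_R ?rR ?sR //.
  by rewrite linv_L ?rR ?sL ?eqxx.
move=> [g]; rewrite in_set (maxgroup_predE ee) => /andP[/eqP gR /eqP gL] ->.
have gr : idealL (r * g) = idealL e.
  by rewrite (eqL_mulr g rL) (leR_idem ee (eqR_le gR)).
split; apply/eqP => //; rewrite -rR (eqR_mull r gR).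
by rewrite (leL_idem ee (eqL_le rL)).
Qed.
End HClasses.

Section LevelClass.
Variables (k : fieldType) (S : finMonoidType).
Local Notation kS := (monalgebra k S).
Local Notation be := (ma_basis k).
Local Notation level := (@level S).
Variable c : nat -> kS.
Hypotheses (cP : forall h, left_id_of (level h) (c h))
  (cS : forall h, c h * c h.+1 = c h).
Variables (h : nat) (e : S).
Hypotheses (ee : (e * e)%g = e) (eI : e \in level h.+1) (neI : e \notin level h).

Local Notation f := (diag c h).
Let idh : ideal (level h) := @ideal_level S h.
Let idh1 : ideal (level h.+1) := @ideal_level S h.+1.

Let Jlevel u : idealJ u = idealJ e -> u \in level h.+1 /\ u \notin level h.
Proof.
move=> uJ; split; first exact: ideal_leJ idh1 (eqJ_le uJ) eI.
by apply: contra neI; apply: ideal_leJ (eqJ_le (esym uJ)).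
Qed.

Let Llevel u : idealL u = idealL e -> u \in level h.+1 /\ u \notin level h.
Proof. by move=> uL; apply/Jlevel/eqL_eqJ. Qed.

(* For s, t in the L-class of e, dcoef s * t is f * (linv s * t), an element  *)
(* of the group up to f, if s R t, and 0 otherwise.                           *)
Definition dcoef s : kS := f * lin_ext (Rcoef k e s) (c h.+1).

Lemma dcoef_mul s x : x \in kspan (level h.+1) ->
  dcoef s * x = f * lin_ext (Rcoef k e s) x.
Proof.
move=> xI; rewrite /dcoef -mulrA; apply: (diag_eq cP).
exact: (Rcoef_left_id e idh (@level_stableR S h) (cP h.+1)).
Qed.

Lemma dcoef_c s : dcoef s * c h.+1 = dcoef s.
Proof. by rewrite dcoef_mul // (c_span cP). Qed.

Lemma Rcoef_span I s x : ideal I -> x \in kspan I ->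
  lin_ext (Rcoef k e s) x \in kspan I.
Proof.
move=> idI xI; rewrite (kspan_decomp xI) linear_sum; apply: rpred_sum => u uI.
rewrite linearZ /= lin_ext_basis rpredZ // /Rcoef.
by case: ifP; rewrite ?rpred0 // kspan_basis ideal_mull.
Qed.

Lemma dcoef_diag s : dcoef s * f = dcoef s.
Proof.
rewrite mulrBr dcoef_c dcoef_mul ?(c_span_le cP) //.
by rewrite (diag_kill cP) ?subr0 // Rcoef_span // (c_span cP).
Qed.

Lemma dcoef_e s : idealL s = idealL e -> dcoef e * dcoef s = dcoef s.
Proof.
move=> sL; rewrite {2}/dcoef mulrA dcoef_diag dcoef_mul; last first.
  by rewrite Rcoef_span // (c_span cP).
congr (_ * _); rewrite {2}/lin_ext linear_sum; apply: eq_bigr => u _.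
rewrite linearZ /=; congr (_ *: _); rewrite /Rcoef; case: eqP => [uR|_].
  rewrite lin_ext_basis linv_R // eqxx; congr (be _).
  have ev := leR_idem ee (eqR_le (linv_R ee sL uR)).
  by rewrite -{1}ev mulgA (proj1 (linvP ee (erefl (idealL e)))) ev.
by rewrite linear0.
Qed.

Definition Jproj u : kS := if idealJ u == idealJ e then be u else 0.

(* \sum_s acoef s (x) dcoef s, over s in the L-class of e, corresponds to the *)
(* separability idempotent 1/|G| \sum_g g (x) g^-1 of kG under the Morita     *)
(* equivalence of kG with the block of the J-class of e.                      *)
Definition acoef s : kS := #|maxgroup_pred e|%:R^-1 *: (f * be s * dcoef e).

(** The term at s is 1/|G| times the part of [c h.+1] in the R-class of s, up to [diag c h]. Each
    R-class of J contains |G| such s, which cancels the denominator. *)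
Lemma sum_acoef_dcoef : #|maxgroup_pred e|%:R != 0 :> k ->
  \sum_(s in Lclass e) acoef s * dcoef s = f * lin_ext Jproj (c h.+1).
Proof.
move=> card_nz.
pose Rproj s u : kS := if idealR u == idealR s then be u else 0.
have term s : s \in Lclass e ->
    f * be s * dcoef e * dcoef s = f * lin_ext (Rproj s) (c h.+1).
  rewrite in_Lclass => /eqP sL; rewrite -mulrA dcoef_e // /dcoef mulrA.
  rewrite (diag_diag cP) ?Rcoef_span ?(c_span cP) // -mulrA; congr (_ * _).
  rewrite /lin_ext mulr_sumr; apply: eq_bigr => u _; rewrite -scalerAr.
  congr (_ *: _); rewrite /Rcoef /Rproj; case: eqP => [uR|_]; last exact: mulr0.
  by rewrite ma_basisM mul_linv_R.
under eq_bigr => s sL do rewrite -scalerAl term //.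
rewrite -scaler_sumr -mulr_sumr scalerAr; congr (_ * _).
rewrite exchange_big scaler_sumr; apply: eq_bigr => u _ /=.
rewrite -scaler_sumr scalerA mulrC -scalerA; congr (_ *: _).
rewrite /Jproj; case: eqP => [uJ|uJ]; last first.
  rewrite big1 ?scaler0 // => s; rewrite in_Lclass => /eqP sL.
  rewrite /Rproj; case: eqP => // uR; case: uJ.
  by rewrite (eqR_eqJ uR) (eqL_eqJ sL).
rewrite (bigID (fun s => idealR u == idealR s)) /= [X in _ + X]big1 => [|s]; last first.
  by move=> /andP[_ /negPf nR]; rewrite /Rproj nR.
rewrite addr0 (eq_bigr (fun=> be u)) => [|s /andP[_ uR]]; last by rewrite /Rproj uR.
rewrite (eq_bigl (mem [set s in Lclass e | idealR u == idealR s])) => [|s]; last first.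
  by rewrite [RHS]in_set.
by rewrite sumr_const card_HLclass // -scaler_nat scalerA mulVf // scale1r.
Qed.
Lemma diag_basis y s : diagonal c y -> idealL s = idealL e ->
  y * (f * be s) = \sum_(v in Lclass e) (y * be s) v *: (f * be v).
Proof.
move=> yT sL; rewrite mulrA (diagonal_diag _ yT) -mulrA {1}[y * be s]ma_decomp.
rewrite mulr_sumr [RHS]big_mkcond; apply: eq_bigr => v _; rewrite -scalerAr.
case: ifPn => // vL; have [vh|vh] := boolP (v \in level h).
  by rewrite (diag_kill cP) ?scaler0 // kspan_basis.
rewrite ma_mul_basis big1 ?scale0r // => w /eqP wv; case/negP: vL.
rewrite in_Lclass -wv; apply/eqP; rewrite -sL.
by apply: (@level_stableL _ h); rewrite ?wv //; case: (Llevel sL).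
Qed.

(** The coefficients [(y * be s) v] form the matrix of y on the span of the L-class of e modulo
    level h. Here y acts through it on the row coordinates, dually to [diag_basis]. *)
Lemma Rcoef_diag v y u : idealL v = idealL e -> u \in level h.+1 ->
  f * lin_ext (Rcoef k e v) (y * be u) =
  f * \sum_(s in Lclass e) (y * be s) v *: Rcoef k e s u.
Proof.
move=> vL uI.
have suppL s w : s \in level h.+1 -> idealR w = idealR v -> idealL w != idealL s ->
    (y * be s) w = 0.
  move=> sI wR; apply: contraNeq; rewrite ma_mul_basis => nz.
  have /existsP[z /eqP zw] : [exists z, (z * s)%g == w].
    apply: contraNT nz => /existsPn nz; rewrite big1 // => z zw.
    by have := nz z; rewrite zw.
  rewrite -zw; apply/eqP/(@level_stableL _ h) => //; rewrite zw.
  by case: (Jlevel (etrans (eqR_eqJ wR) (eqL_eqJ vL))).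
case: (eqVneq (idealJ u) (idealJ e)) => [uJ|uJ]; last first.
  rewrite /lin_ext !big1 // => w.
    rewrite in_Lclass => /eqP wL; rewrite /Rcoef; case: eqP => [uR|_]; last exact: scaler0.
    by case/eqP: uJ; rewrite (eqR_eqJ uR) (eqL_eqJ wL).
  move=> _; rewrite /Rcoef; case: eqP => [wR|_]; last exact: scaler0.
  rewrite suppL ?scale0r //; apply: contra uJ => /eqP wL.
  by rewrite -(eqL_eqJ wL) (eqR_eqJ wR) (eqL_eqJ vL).
have [t [tL tR]] := Lclass_rep uJ.
have [tI _] := Llevel tL.
have tu : (t * (linv e t * u))%g = u by apply: mul_linv_R.
rewrite -{1}tu -ma_basisM mulrA.
transitivity (f * (lin_ext (Rcoef k e v) (y * be t) * be (linv e t * u)%g)).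
  apply: (diag_eq cP); apply: (Rcoef_ract e idh (@level_stableR S h)).
  by rewrite kspanMl // kspan_basis.
congr (_ * _).
transitivity (\sum_(w | (w \in Lclass e) && (idealR w == idealR v))
    (y * be t) w *: be (linv e v * w * (linv e t * u))%g).
  rewrite /lin_ext mulr_suml [RHS]big_mkcond; apply: eq_bigr => w _.
  rewrite -scalerAl /Rcoef in_Lclass; case: (eqVneq (idealR w)) => [wR|_].
    rewrite andbT ma_basisM; case: eqVneq => // wL.
    by rewrite suppL ?scale0r // tL.
  by rewrite andbF mul0r scaler0.
rewrite [RHS](bigID (fun s => idealR t == idealR s)) /= [X in _ + X]big1 => [|s]; last first.
  by move=> /andP[_ /negPf nR]; rewrite /Rcoef -tR nR scaler0.
(* Each w in L_e and R_v is v (linv s t) for one s in L_e and R_t; since z t = w exactly when z s =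
   v, the coefficient of y t at w is that of y s at v. *)
rewrite addr0 (reindex_onto (fun s => v * (linv e s * t))%g
  (fun w => t * (linv e w * v))%g) /=; last first.
  move=> w; rewrite in_Lclass => /andP[/eqP wL /eqP wR].
  by have [_ _ _ ] := linv_transl ee wL vL tL (esym wR).
apply: eq_big => [s|s].
  apply/idP/idP => [/andP[/andP[]]|].
    rewrite !in_Lclass => /eqP wL /eqP wR /eqP <-.
    have [-> -> _ _ _] := linv_transl ee wL vL tL (esym wR).
    by rewrite !eqxx.
  rewrite !in_Lclass => /andP[/eqP sL /eqP sR].
  have [-> -> _ -> _] := linv_transl ee sL tL vL sR.
  by rewrite !eqxx.
move=> /andP[/andP[]]; rewrite !in_Lclass => /eqP wL /eqP wR /eqP sE.
have [sL sR _ _ _] := linv_transl ee wL vL tL (esym wR).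
rewrite sE in sL sR.
have [_ _ -> _ zE] := linv_transl ee sL tL vL (esym sR).
rewrite /Rcoef -tR sR eqxx -mulgA tu !ma_mul_basis; congr (_ *: _).
exact: eq_bigl.
Qed.

Lemma dcoef_diagonal v y : diagonal c y -> idealL v = idealL e ->
  dcoef v * y = \sum_(s in Lclass e) (y * be s) v *: dcoef s.
Proof.
move=> yT vL; rewrite -dcoef_c -mulrA yT dcoef_mul ?kspanMl ?(c_span cP) //.
rewrite /dcoef {1}(kspan_decomp (c_span cP h.+1)) [y * _]mulr_sumr.
rewrite [lin_ext _ (\sum_(_ in _) _)]linear_sum mulr_sumr.
transitivity (\sum_(u in level h.+1) c h.+1 u *:
    (f * \sum_(s in Lclass e) (y * be s) v *: Rcoef k e s u)).
  apply: eq_bigr => u uI; rewrite -scalerAr linearZ -scalerAr Rcoef_diag //.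
under [RHS]eq_bigr => s _ do rewrite scalerAr.
rewrite -[RHS]mulr_sumr.
under eq_bigr => u _ do rewrite scalerAr scaler_sumr.
rewrite -mulr_sumr exchange_big /=; congr (_ * _); apply: eq_bigr => s _.
rewrite [in RHS](kspan_decomp (c_span cP h.+1)) [lin_ext _ _]linear_sum.
rewrite scaler_sumr.
apply: eq_bigr => u _; rewrite /= [lin_ext _ _]linearZ /= lin_ext_basis.
by rewrite !scalerA mulrC.
Qed.

(** Left multiplication by y on the [acoef] and right multiplication by y on the [dcoef] are given
    by transposed matrices, with entries [(y * be s) v]. *)
Lemma acoef_balanced y (l : {linear kS -> k^o}) : diagonal c y ->
  \sum_(s in Lclass e) (l (y * acoef s) : k) *: dcoef s =
  \sum_(s in Lclass e) (l (acoef s) : k) *: (dcoef s * y).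
Proof.
move=> yT.
under [RHS]eq_bigr => v vL.
  rewrite in_Lclass in vL; rewrite (dcoef_diagonal yT (eqP vL)) scaler_sumr; over.
rewrite exchange_big /=; apply: eq_bigr => s; rewrite in_Lclass => /eqP sL.
rewrite /acoef -scalerAr mulrA diag_basis // mulr_suml scaler_sumr linear_sum.
rewrite scaler_suml; apply: eq_bigr => v _.
rewrite scalerA; congr (_ *: _); rewrite -scalerAl scalerA mulrC -scalerA linearZ.
by rewrite mulrC.
Qed.

Lemma acoef_diagonal s : diagonal c (acoef s).
Proof.
have := diagonal_corner cP cS h (be s * dcoef e).
rewrite -mulrA -(mulrA (be s)) dcoef_diag mulrA => H j.
by rewrite /acoef -scalerAr -scalerAl H.
Qed.
End LevelClass.

(** * Chains of J-classes *)

Section Chains.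
Variable S : finMonoidType.
Implicit Types (s t u : S).

Lemma leJclassE s t : leJclass (Jclass s) (Jclass t) = leJ s t.
Proof.
apply/forall_inP/idP => [st|st u].
  have sJ : s \in Jclass s by rewrite in_Jclass.
  by apply: (forall_inP (st s sJ)); rewrite in_Jclass.
rewrite inE => /andP[us _]; apply/forall_inP=> v; rewrite inE => /andP[_ tv].
exact: leJ_trans (leJ_trans us st) tv.
Qed.

Lemma Jchain_notin_level h s : s \notin level S h ->
  exists C : {set {set S}},
    [/\ #|C| = h.+1, forall X, X \in C -> exists2 u, X = Jclass u & leJ u s
      & forall X Y, X \in C -> Y \in C -> leJclass X Y || leJclass Y X].
Proof.
elim: h s => [|h IHh] s sh.
  exists [set Jclass s]; split; first exact: cards1.
    by move=> X; rewrite inE => /eqP ->; exists s => //; apply: leJxx.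
  by move=> X Y; rewrite !inE => /eqP -> /eqP ->; rewrite leJclassE leJxx.
have /subsetPn[t] : ~~ (Jdown s \subset level S h) by rewrite inE in sh.
rewrite inE => /andP[ts nst] /IHh[C [cardC leC chainC]].
exists (Jclass s |: C); split.
- rewrite cardsU1 cardC; case: (boolP (_ \in C)) => // /leC[u su ut].
  have us : leJ s u by rewrite -leJclassE su leJclassE leJxx.
  by rewrite (leJ_trans us ut) in nst.
- move=> X /setU1P[->|/leC[u -> ut]]; first by exists s => //; apply: leJxx.
  by exists u => //; apply: leJ_trans ts.
move=> X Y /setU1P[->|XC] /setU1P[->|YC]; last exact: chainC.
- by rewrite leJclassE leJxx.
- have [u -> ut] := leC _ YC; rewrite !leJclassE (leJ_trans ut ts) orbT //.
- have [u -> ut] := leC _ XC; rewrite !leJclassE (leJ_trans ut ts) //.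
Qed.

Lemma chain_longest (C : {set {set S}}) :
  (forall X, X \in C -> exists u, X = Jclass u) ->
  (forall X Y, X \in C -> Y \in C -> leJclass X Y || leJclass Y X) ->
  (forall X, X \in C -> nonzero_Jclass X) ->
  (#|C| <= longest_nonzero_Jchain S)%N.
Proof.
move=> CJ chainC nzC; apply: (bigmax_sup C) => //; apply/and3P; split.
- by apply/subsetP=> X /CJ[u ->]; apply: imset_f.
- by apply/forall_inP.
- by apply/forall_inP=> X XC; apply/forall_inP=> Y YC; apply: chainC.
Qed.

Lemma level_longest : (forall s, nonzero_Jclass (Jclass s)) ->
  level S (longest_nonzero_Jchain S) = [set: S].
Proof.
move=> nz; apply/setP=> s; rewrite in_setT; apply: contraT.
move=> /Jchain_notin_level[C [cardC leC chainC]].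
have : (#|C| <= longest_nonzero_Jchain S)%N.
  apply: chain_longest => // X /leC[u -> _] //; by exists u.
by rewrite cardC ltnn.
Qed.

(** A zero element is unique, so dropping the zero classes shortens a chain by at most one. *)
Lemma level_longest_zero : level S (longest_nonzero_Jchain S).+1 = [set: S].
Proof.
apply/setP=> s; rewrite in_setT; apply: contraT.
move=> /Jchain_notin_level[C [cardC leC chainC]].
pose C' := [set X in C | nonzero_Jclass X].
have CC X : X \in C' -> X \in C by rewrite inE => /andP[].
have leC' : (#|C'| <= longest_nonzero_Jchain S)%N.
  apply: chain_longest => [X /CC/leC[u -> _]|X Y /CC XC /CC YC|X]; first by exists u.
    exact: chainC.
  by rewrite inE => /andP[].
have zeroC X : X \in C :\: C' -> exists2 z, zero_element z & X = [set z].
  rewrite !inE => /andP[+ XC]; rewrite XC /= negbK => /andP[_ /existsP[z]].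
  by move=> /andP[z0 /eqP ->]; exists z.
have : (#|C :\: C'| <= 1)%N.
  apply/card_le1_eqP=> X Y /zeroC[z z0 ->] /zeroC[w w0 ->].
  have /andP[/eqP zw _] := forallP z0 w; have /andP[_ /eqP zw'] := forallP w0 z.
  by rewrite -zw zw'.
have := cardsID C' C; have -> : C :&: C' = C'.
  by apply/setIidPr/subsetP => X /CC.
rewrite cardC => E l1; have := leq_add leC' l1.
by rewrite E addn1 ltnn.
Qed.
End Chains.

(** * The global dimension bound *)

Section GlobalDimension.
Variables (k : fieldType) (S : finMonoidType) (n : nat) (e : 'I_n -> idem_of S).
Local Notation kS := (monalgebra k S).
Local Notation be := (ma_basis k).
Local Notation level := (@level S).
Hypotheses (gc : good_char k S) (trans : Jtransversal e).
Hypothesis lid : forall I : {set S}, ideal I -> has_left_id k I.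

Lemma card_maxgroup (f : idem_of S) : #|maxgroup_pred f| = #|{: maxgroup f}|.
Proof. by rewrite card_sub; apply: eq_card. Qed.

Lemma card_maxgroup_neq0 (f : idem_of S) : #|maxgroup_pred f|%:R != 0 :> k.
Proof.
rewrite card_maxgroup.
have G0 : (0 < #|{: maxgroup f}|)%N by apply/card_gt0P; exists (mg_one f).
apply/negP=> G_0; have [p pk] := natf0_pchar G0 G_0.
by have := gc f pk; rewrite (dvdn_pcharf pk) G_0.
Qed.

Section Nested.
Variables (N : nat) (c : nat -> kS).
Hypothesis levN : level N = [set: S].
Hypotheses (cP : forall h, left_id_of (level h) (c h))
  (cS : forall h, c h * c h.+1 = c h) (c1 : forall h, (N <= h)%N -> c h = 1).

Lemma level_ex (s : S) : exists h : 'I_N, (s \in level h.+1) && (s \notin level h).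
Proof.
have exh : exists h, s \in level h by exists N; rewrite levN inE.
case: (ex_minnP exh) => -[|h] sh minh; first by rewrite inE in sh.
have hN : (h < N)%N by apply: minh; rewrite levN inE.
exists (Ordinal hN); rewrite /= sh; apply/negP=> /minh; by rewrite ltnn.
Qed.

Lemma level_uniq (s : S) h j : s \in level h.+1 -> s \notin level h ->
  s \in level j.+1 -> s \notin level j -> h = j.
Proof.
move=> sh nsh sj nsj; apply/eqP; rewrite eqn_leq leqNgt [(j <= h)%N]leqNgt.
apply/andP; split; apply/negP=> hj.
  by case/negP: nsh; apply: (subsetP (level_sub S hj)).
by case/negP: nsj; apply: (subsetP (level_sub S hj)).
Qed.

(** The tensors of all J-classes are added. Over the J-classes that enter at level h+1, the
    projections of [c h.+1] add up to [c h.+1] modulo level h, so they contribute [diag c h]; and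
    these sum to 1. *)
Lemma diagonal_tensor : exists (a b : 'I_n * S -> kS),
  [/\ \sum_i a i * b i = 1, forall i, diagonal c (a i)
    & forall y, diagonal c y -> balanced_at (A := kS) a b y].
Proof.
pose E i : S := e i.
have /choice[lv lvP] := fun i => level_ex (E i).
have eI i : E i \in level (lv i).+1 by case/andP: (lvP i).
have neI i : E i \notin level (lv i) by case/andP: (lvP i).
have ee i : (E i * E i)%g = E i := idem_mul (e i).
pose a (p : 'I_n * S) := if p.2 \in Lclass (E p.1) then
  acoef c (lv p.1) (E p.1) p.2 else 0.
pose b (p : 'I_n * S) := dcoef c (lv p.1) (E p.1) p.2.
exists a, b; split.
- rewrite -(pair_bigA _ (fun i s => a (i, s) * b (i, s))) /=.
  transitivity (\sum_i diag c (lv i) * lin_ext (Jproj k (E i)) (c (lv i).+1)).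
    apply: eq_bigr => i _.
    rewrite -(sum_acoef_dcoef cP (lv i) (ee i) (card_maxgroup_neq0 (e i))).
    rewrite [RHS]big_mkcond; apply: eq_bigr => s _; rewrite /a /b /=.
    by case: ifP => // _; rewrite mul0r.
  rewrite -(sum_diag cP c1) (partition_big lv predT) //=; apply: eq_bigr => h _.
  transitivity (diag c h *
      lin_ext (fun u => \sum_(i | lv i == h) Jproj k (E i) u) (c h.+1)).
    rewrite (eq_bigr (fun i => diag c h * lin_ext (Jproj k (E i)) (c h.+1))); last first.
      by move=> i /eqP ->.
    rewrite -mulr_sumr; congr (_ * _); rewrite exchange_big; apply: eq_bigr => u _ /=.
    by rewrite scaler_sumr.
  rewrite -[RHS](diag_c_gt cP cS (leqnn h.+1)); apply: (diag_eq cP).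
  rewrite -[X in _ - X](lin_ext_id (I := level h.+1) (g := fun s => be s)) //; last first.
    exact: c_span.
  apply: lin_ext_mod (c_span cP _) => u uI.
  have [i [uJ uniq_i]] := trans u.
  have [uh|uh] := boolP (u \in level h).
    rewrite rpredB ?kspan_basis //; apply: rpred_sum => j _; rewrite /Jproj.
    by case: ifP; rewrite ?rpred0 ?kspan_basis.
  have JE j : (idealJ u == idealJ (E j)) = (j == i).
    apply/eqP/eqP => [uj|->]; last by apply/eqP; rewrite -in_Jclass.
    by apply/esym/uniq_i; rewrite in_Jclass uj.
  have lvi : lv i = h.
    apply/val_inj; apply: (@level_uniq (E i)) => //=.
      apply: ideal_leJ uI; first exact: ideal_level.
      by move: uJ; rewrite inE => /andP[].
    apply: contra uh; apply: ideal_leJ; first exact: ideal_level.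
    by move: uJ; rewrite inE => /andP[].
  rewrite (bigD1 i) ?lvi //= big1 => [|j /andP[_ /negPf ji]]; last first.
    by rewrite /Jproj JE ji.
  by rewrite /Jproj JE eqxx addr0 subrr rpred0.
- move=> [i s]; rewrite /a /=; case: ifP => _; first exact: acoef_diagonal.
  by move=> j; rewrite mulr0 mul0r.
move=> y yT l.
rewrite -(pair_bigA _ (fun i s => (l (y * a (i, s)) : k) *: b (i, s))) /=.
rewrite -(pair_bigA _ (fun i s => (l (a (i, s)) : k) *: (b (i, s) * y))) /=.
apply: eq_bigr => i _.
have := acoef_balanced cP (ee i) (eI i) (neI i) l yT.
rewrite big_mkcond [in RHS]big_mkcond /= => H.
transitivity (\sum_s (if s \in Lclass (E i) then
   (l (y * acoef c (lv i) (E i) s) : k) *: dcoef c (lv i) (E i) s else 0)).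
  apply: eq_bigr => s _; rewrite /a /b /=; case: ifP => // _.
  by rewrite mulr0 linear0 scale0r.
rewrite H; apply: eq_bigr => s _; rewrite /a /b /=; case: ifP => // _.
by rewrite linear0 scale0r.
Qed.

Lemma gl_dim_le_level d : (N <= d.+1)%N -> gl_dim_le kS d.
Proof.
move=> Nd; have [a [b [ab1 aT bal]]] := diagonal_tensor.
apply: (gl_dim_le_tensor (k := k) (A := kS) (fin_gen_monalgebra k S) ab1
  (fun i => bal _ (aT i)) (c := c)).
- by move=> h; apply/bal/diagonal_c.
- by move=> h x; apply: c_mulr.
- move=> h x; exists (diag c h * x * diag c h); first exact/bal/diagonal_corner.
  by exists (x * c h.+1); rewrite (c_split cP).
- by apply: kspan0; apply: (c_span cP 0).
by move=> h dh; apply: c1; apply: leq_trans dh.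
Qed.

(* If S has a zero z then c 1 = z is central, so that the first two blocks    *)
(* can be merged.                                                             *)
Lemma gl_dim_le_level_zero d (z : S) : zero_element z -> (N <= d.+2)%N ->
  gl_dim_le kS d.
Proof.
move=> /forallP z0 Nd; have [a [b [ab1 aT bal]]] := diagonal_tensor.
have zl s : (z * s = z)%g by case/andP: (z0 s) => /eqP.
have zr s : (s * z = z)%g by case/andP: (z0 s) => _ /eqP.
have lev1 : level 1 = [set z].
  apply/setP=> s; rewrite !inE subset0; apply/eqP/eqP => [s0|->].
    have : z \notin Jdown s by rewrite s0 inE.
    have zs : leJ z s by apply/leJP; exists z, 1%g; rewrite mulg1 zl.
    by rewrite inE zs negbK /= => /leJP[x [y ->]]; rewrite zr zl.
  apply/setP=> t; rewrite !inE; apply/negP => /andP[/leJP[x [y ->]]].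
  by rewrite zr zl leJxx.
have c1z : c 1 = be z.
  have := c_id cP (h := 1) (x := be z); rewrite kspan_basis lev1 inE => /(_ (eqxx z)) <-.
  have := kspan_decomp (c_span cP 1); rewrite lev1 big_set1 => ->.
  by rewrite -scalerAl ma_basisM zl.
have c1C x : c 1 * x = x * c 1.
  rewrite c1z {1 2}[x]ma_decomp mulr_sumr mulr_suml.
  apply: eq_bigr => s _.
  by rewrite -scalerAl -scalerAr !ma_basisM zl zr.
(* [c 1] is skipped. The first step then needs [c 2 * x * c 2] to commute with every [c j], which
   for j = 1 is the centrality of [c 1]. *)
pose c' h := if h is h'.+1 then c h'.+2 else 0.
apply: (gl_dim_le_tensor (k := k) (A := kS) (fin_gen_monalgebra k S) ab1
  (fun i => bal _ (aT i)) (c := c')) => //.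
- by case=> [|h]; [apply: bal => j; rewrite mulr0 mul0r | apply/bal/diagonal_c].
- by case=> [|h] x; [rewrite /= !mulr0 | exact: (c_mulr cP)].
- case=> [|h] x /=.
    exists (c 2 * x * c 2); last by exists 0; rewrite mulr0 addr0.
    apply: bal => -[|[|j]].
    + have -> : c 0 = 0 by apply: kspan0; apply: (c_span cP 0).
      by rewrite mulr0 mul0r.
    + by rewrite c1C.
    + by rewrite 2!mulrA (c_mul_ge cP) // -[RHS]mulrA (c_mul_le cP cS).
  exists (diag c h.+2 * x * diag c h.+2); first exact/bal/diagonal_corner.
  by exists (x * c h.+3); rewrite (c_split cP).
by case=> [|h] //= dh; apply: c1; apply: leq_trans Nd _.
Qed.
End Nested.

(** When a zero class exists, the filtration may need one level more than the longest non-zero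
    chain; merging its two lowest blocks compensates. *)
Lemma gl_dim_le_chain : gl_dim_le kS (longest_nonzero_Jchain S - 1).
Proof.
case: (pickP (fun s : S => ~~ nonzero_Jclass (Jclass s))) => [s|nz].
  rewrite negbK => /andP[_ /existsP[z /andP[z0 _]]].
  have [c [cP cS c1]] := nested_left_ids (level_longest_zero S) lid.
  apply: (gl_dim_le_level_zero (level_longest_zero S) cP cS c1 z0).
  by rewrite ltnS subn1 leqSpred.
have levN := level_longest (fun s => negbFE (nz s)).
have [c [cP cS c1]] := nested_left_ids levN lid.
by apply: (gl_dim_le_level levN cP cS c1); rewrite subn1 leqSpred.
Qed.

End GlobalDimension.

(** * Tensor products *)

Section FreeModule.
Variables (R : nzRingType) (K : choiceType).
Import freeg.
Local Notation FG := {freeg K / R}.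

Lemma freegUZ (c : R) (x : K) : [freeg [:: (c, x)]] = c *: [freeg [:: (1, x)]] :> FG.
Proof. by apply/eqP/freeg_eqP=> y; rewrite coeffZ !coeffU mul1r. Qed.

Variables (M : lmodType R) (g : K -> M).

Fact fglift_linear : linear (fglift g : FG -> M).
Proof.
have subg : additive (fglift g : FG -> M) := lift_is_additive g.
have g0 : fglift g (0 : FG) = 0 by rewrite -(subrr (0 : FG)) subg subrr.
have gD (D D' : FG) : fglift g (D + D') = fglift g D + fglift g D'.
  have := subg (D + D') D'; rewrite addrK => ->; exact/esym/subrK.
have Zg c (D : FG) : fglift g (c *: D) = c *: fglift g D.
  rewrite -[in RHS](freeg_sumE D) [c *: D]/(fgscale c D) /fgscale.
  elim: (dom D) => [|x s IHs]; first by rewrite !big_nil g0 scaler0.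
  by rewrite !big_cons !gD scalerDr IHs !liftU scalerA.
by move=> c D D'; rewrite gD Zg.
Qed.
HB.instance Definition _ :=
  GRing.isLinear.Build R FG M _ (fglift g : FG -> M) fglift_linear.

Definition free_lift : {linear FG -> M} := fglift g.

Lemma free_liftE x : free_lift [freeg [:: (1, x)]] = g x.
Proof. by rewrite /free_lift /= liftU scale1r. Qed.

Lemma free_linear_ext (f f' : {linear FG -> M}) :
  (forall x, f [freeg [:: (1, x)]] = f' [freeg [:: (1, x)]]) -> f =1 f'.
Proof.
move=> ff' D; rewrite -[D]freeg_sumE !linear_sum; apply: eq_bigr => x _.
by rewrite freegUZ !linearZ ff'.
Qed.
End FreeModule.

Lemma spanned_gen (R : nzRingType) (M : lmodType R) (X : M -> Prop) x :
  X x -> x \in spanned X.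
Proof. by move=> Xx; apply/asboolP=> N; apply. Qed.

Lemma spanned_sub (R : nzRingType) (M : lmodType R) (X : M -> Prop)
    (N : submodClosed M) x :
  (forall y, X y -> y \in N) -> x \in spanned X -> x \in N.
Proof. by move=> XN /asboolP; apply. Qed.

Section QuotLift.
Variables (R : nzRingType) (M : lmodType R) (N : submodClosed M) (Y : lmodType R).
Variable f : {linear M -> Y}.
Definition quot_lift of (forall x, x \in N -> f x = 0) :=
  fun x : quot_mod N => f (quot_repr x).

Hypothesis fN : forall x, x \in N -> f x = 0.

Lemma quot_liftE x : quot_lift fN (quot_pi N x) = f x.
Proof.
apply/eqP; rewrite -subr_eq0 -linearB fN //.
by apply/quot_piE; rewrite quot_reprK.
Qed.

Fact quot_lift_linear : linear (quot_lift fN).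
Proof.
move=> a x y; rewrite -[x]quot_reprK -[y]quot_reprK -linearP !quot_liftE.
exact: linearP.
Qed.
HB.instance Definition _ :=
  GRing.isLinear.Build R (quot_mod N) Y _ (quot_lift fN) quot_lift_linear.
End QuotLift.

Section TensorTheory.
Import freeg.
Variables (A R : nzRingType) (V : rmodType A) (B : bimodule A R).
Implicit Types (v w : V) (b : B).

Lemma tensDl v w b : tens (v + w) b = tens v b + tens w b.
Proof. by rewrite -quot_piD; apply/quot_piE/spanned_gen/TensorDl. Qed.
Lemma tensDr v b b' : tens v (b + b') = tens v b + tens v b'.
Proof. by rewrite -quot_piD; apply/quot_piE/spanned_gen/TensorDr. Qed.
Lemma tensA v (a : A) b : tens (v ** a) b = tens v (lact a b).
Proof. by apply/quot_piE/spanned_gen/TensorA. Qed.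
Lemma tensZ v b (r : R) : tens v (b ** r) = tens v b ** r.
Proof.
change (tens v (b ** r) = quot_scale (r : R^c) (tens v b)).
by rewrite quot_scale_pi; apply/quot_piE/spanned_gen/TensorZ.
Qed.

Lemma tens0r v : tens v (0 : B) = 0.
Proof. by apply: (addrI (tens v 0)); rewrite -tensDr !addr0. Qed.

Variable Y : rmodType R.

Lemma tensor_ext (f f' : {linear tensor V B -> Y}) :
  (forall v b, f (tens v b) = f' (tens v b)) -> f =1 f'.
Proof.
move=> ff' x; rewrite -[x]quot_reprK.
pose FG : lmodType R^c := {freeg (V * B) / R^c}.
pose p : {linear FG -> tensor V B} := quot_pi (spanned (@tensor_rel A R V B : FG -> Prop)).
apply: (@free_linear_ext R^c (V * B)%type Y (f \o p)%FUN (f' \o p)%FUN) => -[v b].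
exact: ff'.
Qed.

Lemma tensor_lift (beta : V -> B -> Y) :
  (forall v w b, beta (v + w) b = beta v b + beta w b) ->
  (forall v b b', beta v (b + b') = beta v b + beta v b') ->
  (forall v a b, beta (v ** a) b = beta v (lact a b)) ->
  (forall v b r, beta v (b ** r) = beta v b ** r) ->
  exists f : {linear tensor V B -> Y}, forall v b, f (tens v b) = beta v b.
Proof.
move=> bDl bDr bA bZ.
pose FG : lmodType R^c := {freeg (V * B) / R^c}.
pose g : {linear FG -> Y} := free_lift (fun p : V * B => beta p.1 p.2).
have gE v b : g (tensor_sym v b) = beta v b by rewrite /g free_liftE.
have gN (x : FG) : x \in spanned (@tensor_rel A R V B : FG -> Prop) -> g x = 0.
  move=> xN; apply/eqP; suff : x \in linker g by rewrite inE.
  apply: spanned_sub xN => y []; move=> *; rewrite inE linearB subr_eq0.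
  - by rewrite linearD !gE bDl.
  - by rewrite linearD !gE bDr.
  - by rewrite !gE -bA.
  - by rewrite linearZ_LR !gE; apply/eqP/bZ.
exists (quot_lift gN) => v b.
by rewrite -gE; apply: quot_liftE.
Qed.
End TensorTheory.

(** * Induced modules *)

Section InducedBimodule.
Variables (k : fieldType) (S : finMonoidType) (e : idem_of S).
Local Notation kS := (monalgebra k S).
Local Notation G := (maxgroup e).
Local Notation kG := (monalgebra k G).
Local Notation be := (ma_basis k).
Local Notation eS := (idem_val e).
Local Notation NJ := (@kJdown k S e).
Local Notation B := (ind_bimodule k e).
Local Notation incl := (@maxgroup_incl k S e).
Local Notation kJ := (kspan (Jdown e)).

Let idJ : ideal (Jdown e) := @Jdown_isideal S e.
Let ee : (eS * eS)%g = eS := idem_mul e.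

Lemma in_kJdown (x : kS) : (x \in NJ) = (x \in kJ).
Proof. by apply/kJdownP/kspanP. Qed.

Fact incl_linear : linear incl.
Proof.
move=> c x y; rewrite maxgroup_inclD scaler_sumr; congr (_ + _).
by apply: eq_bigr => g _; rewrite ffunE scalerA.
Qed.
HB.instance Definition _ := GRing.isLinear.Build k kG kS _ incl incl_linear.

Lemma incl_basis (g : G) : incl (be g) = be (g : S).
Proof.
rewrite /maxgroup_incl (bigD1 g) //= big1 => [|h /negPf nh].
  by rewrite ffunE eqxx scale1r addr0.
by rewrite ffunE nh scale0r.
Qed.

Lemma incl1 : incl 1 = be eS.
Proof. exact: incl_basis. Qed.

Lemma incl_val (x : kG) (g : G) : incl x (g : S) = x g.
Proof.
rewrite sum_ffunE (bigD1 g) //= big1 => [|h nh].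
  by rewrite !ffunE eqxx addr0 /GRing.scale /= mulr1.
rewrite !ffunE /GRing.scale /=; case: eqP => [/val_inj gh|]; last by rewrite mulr0.
by rewrite gh eqxx in nh.
Qed.

Lemma incl_out (x : kG) (t : S) : t \notin maxgroup_pred eS -> incl x t = 0.
Proof.
move=> tG; rewrite sum_ffunE big1 // => g _; rewrite !ffunE /GRing.scale /=.
by case: eqP => [tg|]; rewrite ?mulr0 //; rewrite tg (valP g) in tG.
Qed.

Lemma be_e_incl (x : kG) : be eS * incl x = incl x.
Proof. by rewrite -incl1 -maxgroup_inclM mul1r. Qed.
Lemma incl_be_e (x : kG) : incl x * be eS = incl x.
Proof. by rewrite -incl1 -maxgroup_inclM mulr1. Qed.

Fact ibar_subproof (x : kS) :
  (quot_pi NJ (be eS * x) : Jquotient k e) \in corner_pred incl.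
Proof.
rewrite inE; apply/eqP; apply: etrans (quot_lact_pi (@kJdown_stable k S e) _ _) _.
by rewrite incl1 /= mulrA ma_basisM ee.
Qed.
Definition ibar (x : kS) : B := Corner (ibar_subproof x).

Lemma ibar_eq x y : ibar x = ibar y <-> be eS * (x - y) \in kJ.
Proof.
rewrite -in_kJdown mulrBr; split=> [/(congr1 val)/quot_piE //|xy].
by apply/val_inj/quot_piE.
Qed.

Lemma ibarD x y : ibar (x + y) = ibar x + ibar y.
Proof. by apply: val_inj; rewrite /= mulrDr quot_piD. Qed.

Lemma ibar_ract x a : ibar (x * a) = ibar x ** a.
Proof.
apply: val_inj; rewrite /= mulrA.
exact: esym (@quot_scale_pi _ _ NJ (a : kS^c) (be eS * x)).
Qed.

Lemma lact_ibar m x : lact m (ibar x) = ibar (incl m * x).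
Proof.
apply: val_inj; apply: etrans (quot_lact_pi (@kJdown_stable k S e) _ _) _.
by rewrite /= !mulrA be_e_incl incl_be_e.
Qed.

Definition irepr (b : B) : kS := quot_repr (val b : quot_mod NJ).

Lemma ireprK : cancel irepr ibar.
Proof.
move=> b; apply: val_inj; have /eqP bP := valP b; rewrite -[RHS]bP /=.
rewrite -[in RHS](quot_reprK (val b : quot_mod NJ)).
apply: etrans (esym (quot_lact_pi (@kJdown_stable k S e) _ _)).
by rewrite incl1.
Qed.

End InducedBimodule.

Section InducedProjective.
Variables (k : fieldType) (S : finMonoidType) (e : idem_of S).
Local Notation kS := (monalgebra k S).
Local Notation G := (maxgroup e).
Local Notation kG := (monalgebra k G).
Local Notation be := (ma_basis k).
Local Notation eS := (idem_val e).
Local Notation incl := (@maxgroup_incl k S e).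
Local Notation kJ := (kspan (Jdown eS)).
Local Notation ibar := (@ibar k S e).
Local Notation irepr := (@irepr k S e).

Let ee : (eS * eS)%g = eS := idem_mul e.
Let idJ : ideal (Jdown eS) := @Jdown_isideal S eS.

Lemma mg_e (g : G) : (eS * mg_val g)%g = mg_val g /\ (mg_val g * eS)%g = mg_val g.
Proof. by case: (maxgroupP g). Qed.

(** A map out of Ind V is a kG-map y on V whose values are killed by each x with e x in kJ. A
    k-linear lift h0 of y acquires both properties when h0(v g^-1) eps g is averaged over g: the
    averaging gives equivariance, [eps] the vanishing. It remains a lift because y v eps = y v. *)
Lemma Ind_projective (V : rmodType kG) : #|{: G}|%:R != 0 :> k ->
  split_idem k eS -> fin_gen V -> projective (Ind V).
Proof.
move=> G_nz [eps epsJ epse] fgV X Y p f surj.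
have [d [bs [co coE]]] := fin_gen_coord (fin_gen_kmod (fin_gen_monalgebra k _) fgV).
pose y v : Y := f (tens v (ibar 1)).
have yD v w : y (v + w) = y v + y w by rewrite /y tensDl linearD.
have yr v x : y v ** x = f (tens v (ibar x)).
  by rewrite -[in RHS](mul1r x) ibar_ract tensZ linear_ract.
have yG v (m : kG) : y (v ** m) = y v ** incl m.
  by rewrite yr /y tensA lact_ibar mulr1.
have y_mod v x : be eS * (x - 1) \in kJ -> y v ** x = y v.
  by move=> xJ; rewrite yr; congr (f (tens v _)); apply/ibar_eq.
have ye v : y v ** be eS = y v.
  by apply: y_mod; rewrite mulrBr mulr1 ma_basisM ee subrr rpred0.
have yeps v : y v ** eps = y v.
  apply: y_mod; have -> : be eS * (eps - 1) = be eS * (eps - be eS).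
    by rewrite !mulrBr mulr1 ma_basisM ee.
  by rewrite kspanMl.
have yZ c (v : kmod V) : y (c *: v) = c *: (y v : kmod Y).
  by rewrite yG linearZ /= incl1 ractZ ye.
have /choice[x0 x0E] : forall i, exists x, p x = y (bs i) by move=> i; apply: surj.
pose h0 (v : kmod V) : kmod X := \sum_i co v 0 i *: (x0 i : kmod X).
have h0_lin : linear h0.
  move=> c v w; rewrite scaler_sumr -big_split; apply: eq_bigr => i _ /=.
  by rewrite linearP !mxE scalerDl scalerA.
pose lh0 : {linear kmod V -> kmod X} :=
  HB.pack h0 (GRing.isLinear.Build k (kmod V) (kmod X) _ h0 h0_lin).
have ph0 v : p (h0 v) = y v.
  have y0 : y 0 = 0 by apply: (addrI (y 0)); rewrite -yD !addr0.
  rewrite {2}[v]coE /h0 linear_sum (big_morph y yD y0).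
  apply: eq_bigr => i _; rewrite yZ -x0E; exact: linear_ract.
pose r : k := #|{: G}|%:R^-1.
have rE (a b : X) : a = b -> r *: (a : kmod X) = r *: (b : kmod X) by move->.
pose hsum (v : V) : X := \sum_(g : G) h0 (v ** be g^-1%g) ** (eps * be (mg_val g)).
pose h (v : V) : X := r *: (hsum v : kmod X).
have hD v w : h (v + w) = h v + h w.
  rewrite /h -scalerDr; apply: rE; rewrite /hsum -big_split.
  apply: eq_bigr => g _; rewrite ractDl [h0 _](raddfD lh0); exact: ractDl.
have h_ract v x : h v ** x = r *: (hsum v ** x : kmod X) by rewrite kmodZ_ract.
have hJ v x : be eS * x \in kJ -> h v ** x = 0.
  move=> xJ; rewrite h_ract /hsum ract_suml big1 ?scaler0 // => g _.
  rewrite ractA -mulrA; have [_ ge] := mg_e g.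
  by rewrite -ge -ma_basisM -mulrA [eps * _]epsJ ?ract0 // kspanMl.
have hg v (g : G) : h (v ** be g) = h v ** be (mg_val g).
  rewrite h_ract /h; apply: rE; rewrite /hsum ract_suml.
  rewrite (reindex_inj (@mulIg _ g)) /=; apply: eq_bigr => u _.
  rewrite !ractA ma_basisM invgM mulgA mulgV mul1g -mulrA; congr (_ ** (_ * _)).
  by rewrite ma_basisM.
have hZ c v : h (v ** (c%:A : kG)) = h v ** (c%:A : kS).
  rewrite h_ract /h; apply: rE; rewrite /hsum ract_suml.
  apply: eq_bigr => g _; rewrite !ractA mulr_algl mulr_algr !ractZ.
  by rewrite [h0 _](linearZ_LR lh0) kmodZ_ract.
have hm v (m : kG) : h (v ** m) = h v ** incl m.
  have h00 : h 0 = 0 by apply: (addrI (h 0)); rewrite -hD !addr0.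
  rewrite [m]ma_decomp ract_sumr linear_sum ract_sumr (big_morph h hD h00).
  apply: eq_bigr => g _; rewrite /= [incl _]linearZ_LR /= incl_basis.
  by rewrite -[in LHS]mulr_algl -ractA hg hZ ractA mulr_algl.
have ph v : p (h v) = y v.
  rewrite /h; transitivity (r *: (p (hsum v) : kmod Y)); first exact: linear_ract.
  rewrite /hsum linear_sum (eq_bigr (fun=> y v)) => [|g _].
    rewrite sumr_const; apply: etrans (_ : r *: (#|{: G}|%:R *: (y v : kmod Y)) = _).
      by rewrite scaler_nat.
    by rewrite scalerA mulVf // scale1r.
  rewrite linear_ract ph0 -ractA yeps yG ractA incl_basis ma_basisM.
  have -> : (mg_val g^-1 * mg_val g)%g = mg_val (g^-1 * g)%g by [].
  by rewrite mulVg.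
have [||||F FE] := @tensor_lift _ _ V (ind_bimodule k e) X (fun v b => h v ** irepr b).
- by move=> v w b; rewrite hD ractDl.
- move=> v b b'; rewrite -ractDr; apply/eqP; rewrite -subr_eq0 -ractBr; apply/eqP/hJ.
  by apply/ibar_eq; rewrite ibarD !ireprK.
- move=> v a b; rewrite hm [LHS]ractA; apply/eqP; rewrite -subr_eq0 -ractBr; apply/eqP/hJ.
  by apply/ibar_eq; rewrite -lact_ibar !ireprK.
- move=> v b a; rewrite [RHS]ractA; apply/eqP; rewrite -subr_eq0 -ractBr; apply/eqP/hJ.
  by apply/ibar_eq; rewrite ibar_ract !ireprK.
exists F; apply: (tensor_ext (f := (p \o F)%FUN)) => v b /=.
by rewrite FE linear_ract ph yr ireprK.
Qed.
End InducedProjective.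

(** * Splitting from projectivity of induced modules *)

Section CyclicSubmodules.
Variables (R : nzRingType) (M : lmodType R).

Definition cyclic_pred (x : M) : {pred M} := [pred y | `[< exists a, y = a *: x >]].
Fact cyclic_submod x : submod_closed (cyclic_pred x).
Proof.
split=> [|a y z /asboolP[b ->] /asboolP[c ->]]; apply/asboolP.
  by exists 0; rewrite scale0r.
by exists (a * b + c); rewrite scalerDl scalerA.
Qed.
HB.instance Definition _ x :=
  GRing.isSubmodClosed.Build R M (cyclic_pred x) (cyclic_submod x).

Lemma simple_fin_gen : simple_module M -> fin_gen M.
Proof.
move=> [[x x0] sub]; exists 1%N, (fun=> x) => y.
have [N0|NT] := sub (cyclic_pred x).
  case/eqP: x0; apply: N0; apply/asboolP; exists 1; exact/esym/scale1r.
have /asboolP[a ->] := NT y; exists (fun=> a); by rewrite big_ord1.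
Qed.

Definition preim_pred (M' : lmodType R) (f : {linear M' -> M}) (N : submodClosed M) :
  {pred M'} := [pred x | f x \in N].
Fact preim_submod M' f N : submod_closed (@preim_pred M' f N).
Proof.
split=> [|a x y]; rewrite !inE ?linear0 ?rpred0 // => fx fy.
by rewrite linearP rpredD ?rpredZ.
Qed.
HB.instance Definition _ M' f N :=
  GRing.isSubmodClosed.Build R M' (@preim_pred M' f N) (@preim_submod M' f N).

End CyclicSubmodules.

Section MaximalIdeals.
Variables (k : fieldType) (G : finMonoidType).
Local Notation kG := (monalgebra k G).
Local Notation kGr := ((kG^c)^o : lmodType kG^c).

(** Dimension takes the place of Zorn: among proper right ideals above L, one is chosen that
    contains a subspace U of largest dimension. A larger proper ideal would allow U to grow by a
    line. *)
Lemma maximal_right_ideal (L : submodClosed kGr) : (1 : kG) \notin L ->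
  exists M : submodClosed kGr, [/\ forall x, x \in L -> x \in M, (1 : kG) \notin M
    & forall N : submodClosed kGr, (forall x, x \in M -> x \in N) ->
      (1 : kG) \notin N -> forall x, x \in N -> x \in M].
Proof.
move=> L1; pose V : vectType k := {ffun G -> k^o}.
pose P d := `[< exists (M : submodClosed kGr) (U : {vspace V}),
  [/\ forall x, x \in L -> x \in M, (1 : kG) \notin M,
      forall x : V, x \in U -> (x : kG) \in M & \dim U = d] >].
have exP : exists d, P d.
  exists 0%N; apply/asboolP; exists L, 0%VS; split=> // [x|]; last exact: dimv0.
  by rewrite memv0 => /eqP ->; apply: rpred0.
have bndP d : P d -> (d <= \dim {: V})%N.
  by move=> /asboolP[M [U [_ _ _ <-]]]; apply/dimvS/subvf.
case: (ex_maxnP exP bndP) => d /asboolP[M [U [LM M1 UM dimU]]] max_d.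
exists M; split=> // N MN N1 x xN; apply: contraT => xM.
have xU : (x : V) \notin U by apply: contra xM => /UM.
suff /max_d : P d.+1 by rewrite ltnn.
apply/asboolP; exists N, (U + <[x : V]>)%VS; split=> // [y /LM/MN //|y|].
  move=> /memv_addP[u /UM/MN uN [_ /vlineP[c ->] ->]].
  apply: rpredD => //.
  have -> : c *: (x : V) = (x : kG) * (c%:A : kG) by rewrite mulr_algr.
  exact: (rpredZ (c%:A : kG^c)).
rewrite dimv_disjoint_sum ?dim_vline ?dimU.
  suff -> : (x : V) != 0 by rewrite addn1.
  by apply: contra xU => /eqP ->; apply: mem0v.
apply/eqP; rewrite -subv0; apply/subvP=> y /memv_capP[yU /vlineP[c yE]].
rewrite memv0 yE; have [->|c0] := eqVneq c 0; first by rewrite scale0r.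
by case/negP: xU; rewrite -(scalerK c0 (x : V)) -yE memvZ.
Qed.

Lemma simple_quotient (M : submodClosed kGr) : (1 : kG) \notin M ->
  (forall N : submodClosed kGr, (forall x, x \in M -> x \in N) ->
      (1 : kG) \notin N -> forall x, x \in N -> x \in M) ->
  simple_module (quot_mod M).
Proof.
move=> M1 maxM; split.
  exists (quot_pi M (1 : kG)); apply: contra M1 => /eqP q0.
  have /quot_piE : quot_pi M (1 : kG) = quot_pi M 0 by rewrite q0 raddf0.
  by rewrite subr0.
move=> N; have [N1|N1] := boolP ((1 : kG) \in preim_pred (quot_pi M) N).
  right=> x; rewrite -(quot_reprK x).
  have -> : quot_repr x = (quot_repr x : kG^c) *: (1 : kGr).
    by rewrite /GRing.scale /= mulr1.
  by rewrite linearZ rpredZ //; rewrite inE in N1.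
left=> x xN; rewrite -(quot_reprK x) -(raddf0 (quot_pi M)); apply/quot_piE.
rewrite subr0; apply: maxM N1 _ _; last first.
  by change (quot_pi M (quot_repr x) \in N); rewrite quot_reprK.
move=> y yM; change (quot_pi M y \in N); suff -> : quot_pi M y = 0 by apply: rpred0.
by rewrite -(raddf0 (quot_pi M)); apply/quot_piE; rewrite subr0.
Qed.
End MaximalIdeals.

Section GroupComponent.
Variables (k : fieldType) (S : finMonoidType) (e : idem_of S).
Local Notation kS := (monalgebra k S).
Local Notation G := (maxgroup e).
Local Notation kG := (monalgebra k G).
Local Notation kGr := ((kG^c)^o : lmodType kG^c).
Local Notation be := (ma_basis k).
Local Notation eS := (idem_val e).
Local Notation incl := (@maxgroup_incl k S e).
Local Notation kJ := (kspan (Jdown eS)).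
Local Notation B := (ind_bimodule k e).
Local Notation ibar := (@ibar k S e).
Local Notation irepr := (@irepr k S e).

Let ee : (eS * eS)%g = eS := idem_mul e.
Let idJ : ideal (Jdown eS) := @Jdown_isideal S eS.

(** A left kG-linear retraction of [incl] that factors through [ibar], because G is disjoint from
    [Jdown e]. *)
Definition grestr (x : kS) : kG := [ffun g : G => (be eS * x) (mg_val g)].

Lemma grestrE x g : grestr x g = (be eS * x) (mg_val g).
Proof. exact: ffunE. Qed.

Lemma ma_addE T (x y : monalgebra k T) t : (x + y) t = x t + y t.
Proof. exact: ffunE. Qed.

Fact grestr_linear : linear grestr.
Proof.
move=> c x y; apply/ffunP=> g.
by rewrite ma_addE ma_scaleE !grestrE mulrDr -scalerAr ma_addE ma_scaleE.
Qed.
HB.instance Definition _ := GRing.isLinear.Build k kS kG _ grestr grestr_linear.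

Lemma maxgroup_notin_Jdown (g : G) : mg_val g \notin Jdown eS.
Proof.
have := valP g; rewrite (maxgroup_predE ee) JdownE => /andP[/eqP gR _].
by rewrite (eqR_eqJ gR) eqxx andbF.
Qed.

Lemma grestr_ibar x y : ibar x = ibar y -> grestr x = grestr y.
Proof.
move=> /ibar_eq/kspanP xy; apply/eqP; rewrite -subr_eq0 -linearB; apply/eqP/ffunP=> g.
by rewrite grestrE xy ?maxgroup_notin_Jdown // ffunE.
Qed.

Lemma mg_inv_eq (u g : G) (w : S) :
  (mg_val u * w == mg_val g)%g = (eS * w == mg_val (u^-1 * g))%g.
Proof.
have [eu ue _] := maxgroupP u; have [eg _ _] := maxgroupP g.
have uu : (mg_val u * mg_val u^-1)%g = eS.
  by transitivity (mg_val (u * u^-1)%g) => //; rewrite mulgV.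
have u'u : (mg_val u^-1 * mg_val u)%g = eS.
  by transitivity (mg_val (u^-1 * u)%g) => //; rewrite mulVg.
have -> : mg_val (u^-1 * g)%g = (mg_val u^-1 * mg_val g)%g by [].
apply/eqP/eqP => [<-|uw]; first by rewrite mulgA u'u.
by rewrite -ue -mulgA uw mulgA uu eg.
Qed.

Lemma grestr_incl (m : kG) x : grestr (incl m * x) = m * grestr x.
Proof.
rewrite [m]ma_decomp linear_sum !mulr_suml linear_sum; apply: eq_bigr => u _ /=.
rewrite [incl _]linearZ_LR /= incl_basis -!scalerAl [grestr _]linearZ_LR /=.
congr (_ *: _); apply/ffunP=> g; rewrite grestrE mulrA ma_basisM.
have [-> _ _] := maxgroupP u; rewrite !ma_basis_mull.
rewrite (eq_bigl _ _ (mg_inv_eq u g)) [RHS](bigD1 (u^-1 * g)%g) /=; last first.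
  by rewrite mulgA mulgV mul1g.
rewrite [X in _ = _ + X]big1 => [|w /andP[/eqP uw /eqP]]; last by rewrite -uw mulKg.
by rewrite addr0 grestrE ma_basis_mull.
Qed.

Lemma grestr_e : grestr (be eS) = 1.
Proof.
by apply/ffunP=> g; rewrite grestrE ma_basisM ee ffunE [RHS]ffunE -val_eqE.
Qed.

(* An element of eSe strictly below e lies in Jdown e, any other in G.        *)
Lemma incl_grestr x : be eS * (x * be eS) - incl (grestr (x * be eS)) \in kJ.
Proof.
set y := x * be eS; apply/kspanP=> t tJ.
rewrite ma_addE; have -> (z : kS) : (- z) t = - z t by rewrite ffunE.
have [tG|tG] := boolP (t \in maxgroup_pred eS).
  by rewrite (incl_val _ (MaxGroup tG)) grestrE subrr.
rewrite incl_out // subr0.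
have [et|et] := eqVneq (eS * t)%g t; last first.
  rewrite ma_basis_mull big1 // => w /eqP wt; case/eqP: et.
  by rewrite -wt mulgA ee.
have [te|te] := eqVneq (t * eS)%g t; last first.
  rewrite /y mulrA ma_mul_basis big1 // => w /eqP wt; case/eqP: te.
  by rewrite -wt -mulgA ee.
case/negP: tG; rewrite (maxgroup_predE ee).
have tJe : idealJ t = idealJ eS.
  apply/eqP; apply: contraNT tJ => tJ; rewrite JdownE tJ andbT.
  by rewrite -et leJ_mulr.
by have [-> ->] := Jclass_corner tJe et te; rewrite !eqxx.
Qed.

(** The obstruction to splitting: a right ideal of kG that contains 1 only if [split_idem] holds. *)
Definition split_ideal : {pred kGr} := [pred w : kGr | `[< exists h : kS,
  (forall x, x \in kJ -> h * x = 0) /\ be eS * h - incl w \in kJ >]].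
Fact split_ideal_submod : submod_closed split_ideal.
Proof.
split=> [|a v w /asboolP[h [hJ hv]] /asboolP[h' [h'J h'w]]]; apply/asboolP.
  by exists 0; split=> [x _|]; rewrite ?mul0r // mulr0 linear0 subr0 rpred0.
exists (h * incl a + h'); split=> [x xJ|].
  by rewrite mulrDl h'J // addr0 -mulrA hJ // kspanMl.
have -> : be eS * (h * incl a + h') - incl (a *: v + w) =
    (be eS * h - incl v) * incl a + (be eS * h' - incl w).
  have -> : incl (a *: v + w) = incl v * incl a + incl w.
    by rewrite -maxgroup_inclM -maxgroup_inclD.
  by rewrite mulrBl mulrDr (mulrA (be eS)) opprD addrACA.
by rewrite rpredD // kspanMr.
Qed.

HB.instance Definition _ :=
  GRing.isSubmodClosed.Build kG^c kGr split_ideal split_ideal_submod.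

Lemma split_ideal1 : (1 : kG) \in split_ideal -> split_idem k eS.
Proof.
move=> /asboolP[h [hJ h1]]; exists (be eS * h); last by move: h1; rewrite incl1.
by move=> x xJ; rewrite -mulrA hJ ?mulr0.
Qed.

Section Quotient.
Variable M : submodClosed kGr.

(** A kS-submodule of B that contains M B and is detected in kG; it turns a congruence modulo M B
    into one modulo M. *)
Definition grestr_in : {pred B} :=
  [pred b : B | `[< forall a, (grestr (irepr b * a) : kGr) \in M >]].

Let grestr_repr x a : grestr (irepr (ibar x) * a) = grestr (x * a).
Proof. by apply: grestr_ibar; rewrite !ibar_ract ireprK. Qed.

Fact grestr_in_submod : submod_closed grestr_in.
Proof.
split=> [|r b b' /asboolP Hb /asboolP Hb']; apply/asboolP=> a.
  have -> : (0 : B) = ibar 0.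
    by apply: (addrI (ibar 0)); rewrite -ibarD !addr0.
  by rewrite grestr_repr mul0r linear0 rpred0.
have -> : r *: b + b' = ibar (irepr b * (r : kS) + irepr b').
  by rewrite ibarD ibar_ract !ireprK.
rewrite grestr_repr mulrDl linearD -mulrA.
exact: (rpredD (Hb ((r : kS) * a)) (Hb' a)).
Qed.
HB.instance Definition _ :=
  GRing.isSubmodClosed.Build kS^c B grestr_in grestr_in_submod.

Lemma grestr_in_ibar x a : ibar x \in grestr_in -> (grestr (x * a) : kGr) \in M.
Proof. by move=> /asboolP/(_ a); rewrite grestr_repr. Qed.

Lemma lact_grestr_in (m : kGr) (b : B) : m \in M -> lact (m : kG) b \in grestr_in.
Proof.
move=> mM; apply/asboolP=> a; rewrite -(ireprK b) lact_ibar grestr_repr.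
rewrite -mulrA grestr_incl.
exact: (rpredZ (grestr (irepr b * a) : kG^c)).
Qed.

Let MB : B -> Prop := fun y => exists (m : kGr) b, m \in M /\ y = lact (m : kG) b.

(* Lifting Ind(kG/M) -> B/MB through kS -> B/MB.                              *)
Lemma projective_lift : projective (Ind (quot_mod M)) ->
  exists2 w : kG, (w : kGr) \in split_ideal & (w : kGr) \in M -> (1 : kG) \in M.
Proof.
move=> proj; pose Y : rmodType kS := quot_mod (spanned MB).
pose pi : {linear B -> Y} := quot_pi (spanned MB).
have piM (m : kGr) b : m \in M -> pi (lact (m : kG) b) = 0.
  move=> mM; rewrite -(raddf0 pi); apply/quot_piE; rewrite subr0.
  by apply: spanned_gen; exists m, b.
have lactB (m m' : kG) b : lact (m - m') b = lact m b - lact m' b.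
  by apply/eqP; rewrite eq_sym subr_eq -lactDl subrK.
have pi_lact (m m' : kG) b : (m - m' : kGr) \in M -> pi (lact m b) = pi (lact m' b).
  move=> mm'; have := piM _ b mm'.
  by rewrite lactB linearB => /eqP; rewrite subr_eq0 => /eqP.
have [||||f fE] := @tensor_lift _ _ (quot_mod M) B Y
    (fun v b => pi (lact (quot_repr v : kG) b)).
- move=> v w b; rewrite -linearD -lactDl; apply: pi_lact.
  by apply/quot_piE; rewrite quot_piD !quot_reprK.
- by move=> v b b'; rewrite lactDr linearD.
- move=> v a b; rewrite -lactM; apply: pi_lact.
  apply/quot_piE; rewrite quot_reprK -{1}(quot_reprK v).
  exact: quot_scale_pi.
- by move=> v b r; rewrite -linear_ract [lact _ (_ ** _)]lactZ.
pose X : rmodType kS := (kS^c)^o.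
have p_lin : linear (fun x : X => pi (ibar (x : kS))).
  by move=> a x y; rewrite ibarD ibar_ract linearD linear_ract.
pose p : {linear X -> Y} := HB.pack (fun x : X => pi (ibar (x : kS)))
  (GRing.isLinear.Build kS^c X Y _ _ p_lin).
have p_surj y : exists x, p x = y.
  by exists (irepr (quot_repr y)); rewrite /= ireprK /pi quot_reprK.
have [h ph] := proj X Y p f p_surj.
(* The lift of the generator of Ind(kG/M): kJ kills the generator, hence also [h0]. *)
pose h0 : kS := h (tens (quot_pi M (1 : kG)) (ibar 1)).
pose r : kG := quot_repr (quot_pi M (1 : kG)).
have rM : (1 - r : kGr) \in M by apply/quot_piE; rewrite quot_reprK.
have h0J x : x \in kJ -> h0 * x = 0.
  move=> xJ; transitivity (h (tens (quot_pi M (1 : kG)) (ibar 1)) ** x) => //.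
  rewrite -linear_ract -tensZ -ibar_ract mul1r.
  have -> : ibar x = 0.
    transitivity (ibar 0); first by apply/ibar_eq; rewrite subr0 kspanMl.
    by apply: (addrI (ibar 0)); rewrite -ibarD !addr0.
  by rewrite tens0r linear0.
have h0r : ibar (incl r - h0) \in grestr_in.
  have /quot_piE : pi (ibar (incl r)) = pi (ibar h0).
    by rewrite -[RHS]/(p h0) ph fE -/r lact_ibar mulr1.
  have -> : ibar (incl r) - ibar h0 = ibar (incl r - h0).
    by apply/eqP; rewrite subr_eq -ibarD subrK.
  by apply: spanned_sub => _ [m [b [mM ->]]]; apply: lact_grestr_in.
(* This element is congruent modulo M to [r], and [r] to 1; if it lay in M, so would 1. *)
exists (grestr (h0 * be eS)).
  apply/asboolP; exists (h0 * be eS); split; last exact: incl_grestr.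
  by move=> x xJ; rewrite -mulrA h0J // kspanMl.
move=> wM; have := grestr_in_ibar (be eS) h0r.
rewrite mulrBl linearB /= grestr_incl grestr_e mulr1 => H.
have : (1 - r + (r - grestr (h0 * be eS) + grestr (h0 * be eS)) : kGr) \in M.
  by rewrite rpredD // rpredD.
by rewrite !subrK.
Qed.
End Quotient.

Lemma split_of_projective :
  (forall V : rmodType kG, simple_module V -> projective (Ind V)) ->
  split_idem k eS.
Proof.
move=> proj; apply: split_ideal1; apply: contraT.
move=> /maximal_right_ideal[M [LM M1 maxM]].
have [w wL wM] := projective_lift (proj _ (simple_quotient M1 maxM)).
by case/negP: M1; apply/wM/LM.
Qed.

End GroupComponent.

(** * The sandwich matrix *)

Section Sandwich.
Variables (k : fieldType) (S : finMonoidType) (e : idem_of S).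
Variables lam rho : {set S} -> S.
Local Notation kS := (monalgebra k S).
Local Notation G := (maxgroup e).
Local Notation kG := (monalgebra k G).
Local Notation be := (ma_basis k).
Local Notation eS := (idem_val e).
Local Notation incl := (@maxgroup_incl k S e).
Local Notation kJ := (kspan (Jdown eS)).
Local Notation C := (sandwich k e lam rho).
Local Notation Jle := [set t | leJ t eS].
Hypotheses (lamP : Lrepresentatives eS lam) (rhoP : Rrepresentatives eS rho).

Let ee : (eS * eS)%g = eS := idem_mul e.
Let idJ : ideal (Jdown eS) := @Jdown_isideal S eS.

Let lamb (b : 'I_#|Lclasses_of eS|) := lam (enum_val b).
Let rhoa (a : 'I_#|Rclasses_of eS|) := rho (enum_val a).

Lemma lamb_R b : idealR (lamb b) = idealR eS.
Proof.
by have := lamP (enum_valP b); rewrite inE in_Rclass => /andP[_ /eqP].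
Qed.

Lemma rhoa_L a : idealL (rhoa a) = idealL eS.
Proof.
by have := rhoP (enum_valP a); rewrite inE in_Lclass => /andP[_ /eqP].
Qed.

Lemma lamb_ex t : idealJ t = idealJ eS -> exists b, idealL (lamb b) = idealL t.
Proof.
move=> tJ; have tL : Lclass t \in Lclasses_of eS.
  by apply: imset_f; rewrite in_Jclass tJ.
exists (enum_rank_in tL (Lclass t)); rewrite /lamb enum_rankK_in //.
by have := lamP tL; rewrite inE in_Lclass => /andP[/eqP].
Qed.

Lemma rhoa_ex t : idealJ t = idealJ eS -> exists a, idealR (rhoa a) = idealR t.
Proof.
move=> tJ; have tR : Rclass t \in Rclasses_of eS.
  by apply: imset_f; rewrite in_Jclass tJ.
exists (enum_rank_in tR (Rclass t)); rewrite /rhoa enum_rankK_in //.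
by have := rhoP tR; rewrite inE in_Rclass => /andP[/eqP].
Qed.

Lemma rhoa_inj a a' : idealR (rhoa a) = idealR (rhoa a') -> a = a'.
Proof.
have RE i : enum_val i = Rclass (rhoa i).
  have /imsetP[t _ tE] := enum_valP i.
  have := rhoP (enum_valP i); rewrite -/(rhoa i) inE tE in_Rclass => /andP[/eqP tR _].
  by apply/setP=> u; rewrite !in_Rclass tR.
by move=> R; apply: enum_val_inj; rewrite !RE; apply/setP=> u; rewrite !in_Rclass R.
Qed.

Lemma ideal_Jle : ideal Jle.
Proof. by move=> t u v; rewrite !inE; apply: leJ_trans; apply: leJ_mul. Qed.

Lemma maxgroup_predJ t : idealJ t = idealJ eS -> (eS * t = t)%g -> (t * eS = t)%g ->
  t \in maxgroup_pred eS.
Proof.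
move=> tJ et te; rewrite (maxgroup_predE ee).
by have [-> ->] := Jclass_corner tJ et te; rewrite !eqxx.
Qed.

Lemma sandwich_incl b a : incl (C b a) - be (lamb b * rhoa a)%g \in kJ.
Proof.
rewrite mxE -/(lamb b) -/(rhoa a) /=; set x := (lamb b * rhoa a)%g.
have elb := leR_idem ee (eqR_le (lamb_R b)).
have rae := leL_idem ee (eqL_le (rhoa_L a)).
case: ifPn => xJ.
  have xG : x \in maxgroup_pred eS.
    apply: maxgroup_predJ; first by apply/eqP; rewrite -in_Jclass.
      by rewrite mulgA elb.
    by rewrite -mulgA rae.
  by rewrite incl_basis insubdK // subrr rpred0.
rewrite linear0 sub0r rpredN kspan_basis leJ_Jdown //.
by rewrite /x -elb -mulgA leJ_mulr.
Qed.

(** Take theta to be the sum of the rho_a D_ab lam_b. Modulo kJ, lam_b rho_a' is C_ba', so DC = 1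
    gives theta rho_a' = rho_a'; every element of J is some rho_a' times a right factor. *)
Lemma local_of_left_invertible : left_invertible C -> local_left_id k eS.
Proof.
move=> [D DC]; have idle := ideal_Jle.
exists (\sum_a \sum_b be (rhoa a) * incl (D a b) * be (lamb b)).
  apply: rpred_sum => a _; apply: rpred_sum => b _.
  rewrite kspanMl // kspan_basis inE; exact/leR_leJ/eqR_le/lamb_R.
set theta := \sum_a _.
have thetaE a' : theta * be (rhoa a') - be (rhoa a') \in kJ.
  have rae := leL_idem ee (eqL_le (rhoa_L a')).
  have E : be (rhoa a') = \sum_a \sum_b be (rhoa a) * incl (D a b) * incl (C b a').
    transitivity (\sum_a be (rhoa a) * incl ((D *m C) a a')).
      rewrite DC (bigD1 a') //= big1 => [|a /negPf na].
        by rewrite mxE eqxx addr0 incl1 ma_basisM rae.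
      by rewrite mxE na linear0 mulr0.
    apply: eq_bigr => a _; rewrite mxE linear_sum mulr_sumr; apply: eq_bigr => b _.
    by rewrite /= maxgroup_inclM mulrA.
  rewrite [X in _ - X]E mulr_suml -sumrB; apply: rpred_sum => a _.
  rewrite mulr_suml -sumrB; apply: rpred_sum => b _.
  rewrite -[X in X - _]mulrA ma_basisM -mulrBr kspanMl // -rpredN opprB.
  exact: sandwich_incl.
move=> t; rewrite in_Jclass => /eqP tJ; have [a aR] := rhoa_ex tJ.
rewrite -(mul_linv_R ee (rhoa_L a) (esym aR)) -ma_basisM mulrA -mulrBl.
by rewrite kspanMr.
Qed.

Lemma Rclass_decomp v : idealR v = idealR eS ->
  exists b (g : G), v = (mg_val g * lamb b)%g.
Proof.
move=> vR; have vJ := eqR_eqJ vR; have [b bL] := lamb_ex vJ.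
have /leRP[y eE] := eqR_le (esym (lamb_R b)).
have /leLP[x vE] := eqL_le (esym bL).
have elb := leR_idem ee (eqR_le (lamb_R b)).
have ev := leR_idem ee (eqR_le vR).
have gl : (v * (y * eS) * lamb b)%g = v.
  by rewrite -!mulgA elb {1}vE -mulgA (mulgA (lamb b)) -eE elb -vE.
have gG : (v * (y * eS))%g \in maxgroup_pred eS.
  apply: maxgroup_predJ; last by rewrite -!mulgA ee.
    rewrite -vJ; apply/eqP; rewrite eqEsubset [_ \subset _]leJ_mulr /=.
    by rewrite -{1}gl [_ \subset _]leJ_mulr.
  by rewrite mulgA ev.
by exists b, (MaxGroup gG); rewrite /= gl.
Qed.

(** The component [delta a] of the left identity in the R-class of rho_a, carried back to the
    R-class of e, is a kG-combination of the lam_b; its coefficients are row a of D. By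
    [Rcoef_left_id], [delta a] times rho_a' is e or 0 modulo kJ according to whether a = a', and kG
    meets kJ only in 0. *)
Lemma left_invertible_of_left_id : has_left_id k Jle -> left_invertible C.
Proof.
move=> [eta etaP].
have sep u v : u \in Jle -> (u * v)%g \notin Jdown eS -> idealR (u * v)%g = idealR u.
  rewrite inE => ue uvJ; apply: stableR.
  have uve : leJ (u * v)%g eS by apply: leJ_trans (leJ_mulr _ _) ue.
  move: uvJ; rewrite inE uve negbK /= => euv; exact: leJ_trans ue euv.
pose delta a := lin_ext (Rcoef k eS (rhoa a)) eta.
have deltaE a a' : delta a * be (rhoa a') - (if a == a' then be eS else 0) \in kJ.
  have rJ : be (rhoa a') \in kspan Jle.
    rewrite kspan_basis inE; exact/leL_leJ/eqL_le/rhoa_L.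
  have := Rcoef_left_id eS idJ sep etaP (rhoa a) rJ.
  rewrite lin_ext_basis /Rcoef -/(delta a); case: eqP => [aR|naR].
    rewrite (rhoa_inj aR) eqxx.
    by have [-> _] := linvP ee (rhoa_L a).
  by case: eqP => [aa|//]; case: naR; rewrite aa.
have decomp a u : exists d : 'I_#|Lclasses_of eS| -> kG,
    Rcoef k eS (rhoa a) u = \sum_b incl (d b) * be (lamb b).
  rewrite /Rcoef; case: eqP => [uR|_]; last first.
    by exists (fun=> 0); rewrite big1 // => b _; rewrite linear0 mul0r.
  have [b [g ->]] := Rclass_decomp (linv_R ee (rhoa_L a) uR).
  exists (fun b' => if b' == b then be g else 0).
  rewrite (bigD1 b) //= big1 => [|b' /negPf ->]; last by rewrite linear0 mul0r.
  by rewrite eqxx addr0 incl_basis ma_basisM.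
have /choice[d dE] : forall p, exists d : 'I_#|Lclasses_of eS| -> kG,
    Rcoef k eS (rhoa p.1) p.2 = \sum_b incl (d b) * be (lamb b).
  by move=> [a u]; apply: decomp.
pose D : 'M[kG]_(#|Rclasses_of eS|, #|Lclasses_of eS|) :=
  \matrix_(a, b) \sum_u eta u *: d (a, u) b.
have DE a : delta a = \sum_b incl (D a b) * be (lamb b).
  rewrite /delta /lin_ext.
  under eq_bigr => u _ do rewrite (dE (a, u)) scaler_sumr.
  rewrite exchange_big; apply: eq_bigr => b _; rewrite mxE linear_sum mulr_suml.
  by apply: eq_bigr => u _; rewrite /= [incl (_ *: _)]linearZ_LR scalerAl.
exists D; apply/matrixP=> a a'.
have H : incl ((D *m C) a a' - 1%:M a a') \in kJ.
  have := deltaE a a'; rewrite [incl (_ - _)](raddfB incl) /= DE mulr_suml => dJ.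
  have -> : incl (1%:M a a') = if a == a' then be eS else 0.
    by rewrite mxE; case: eqP => _; rewrite ?linear0 ?incl1.
  rewrite -(subrKA (\sum_b incl (D a b) * be (lamb b) * be (rhoa a'))) rpredD //.
  rewrite mxE linear_sum -sumrB; apply: rpred_sum => b _.
  rewrite /= maxgroup_inclM -mulrA ma_basisM -mulrBr kspanMl //.
  exact: sandwich_incl.
apply/eqP; rewrite -subr_eq0; apply/eqP/ffunP=> g.
by rewrite -incl_val (kspanP _ _ H) ?maxgroup_notin_Jdown // ffunE.
Qed.
End Sandwich.

(** * The theorem *)

Lemma split_of_left_id (k : fieldType) (S : finMonoidType) (e : S) :
  has_left_id k (Jdown e) -> split_idem k e.
Proof.
move=> [eta [etaJ etaE]]; have idJ := @Jdown_isideal S e.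
exists (ma_basis k e - ma_basis k e * eta) => [x xJ|].
  by rewrite mulrBl -mulrA etaE // subrr.
by rewrite addrAC subrr sub0r rpredN kspanMl.
Qed.

Theorem theorem4p4 (k : fieldType) (S : finMonoidType)
    (n : nat) (e : 'I_n -> idem_of S) (lam rho : 'I_n -> {set S} -> S) :
  regular_monoid S ->
  good_char k S ->
  Jtransversal e ->
  (forall i, Lrepresentatives (e i) (lam i)) ->
  (forall i, Rrepresentatives (e i) (rho i)) ->
  (directed k e <->
     forall i, left_invertible (sandwich k (e i) (lam i) (rho i))) /\
  (directed k e ->
     gl_dim_le (monalgebra k S) (longest_nonzero_Jchain S - 1)).
Proof.
move=> _ gc trans lamP rhoP.
have Jrep (s : S) : exists i, idealJ s = idealJ (e i).
  by have [i [sJ _]] := trans s; exists i; apply/eqP; rewrite -in_Jclass.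
have lid_of_directed : directed k e ->
    forall I : {set S}, ideal I -> has_left_id k I.
  move=> [_ proj]; apply: left_id_of_split => s; have [i sJ] := Jrep s.
  exists (e i); split=> //; first exact: idem_mul.
  exact: split_of_projective (proj i).
split; last by move=> /lid_of_directed; apply: gl_dim_le_chain gc trans.
split=> [/lid_of_directed lid i|inv].
  by apply: left_invertible_of_left_id => //; apply/lid/ideal_Jle.
split=> // i V simpleV; apply: Ind_projective (simple_fin_gen simpleV).
  by rewrite -card_maxgroup card_maxgroup_neq0.
apply/split_of_left_id/left_id_of_local/Jdown_isideal => s.
have [j sJ] := Jrep s; exists (e j) => //.
exact: local_of_left_invertible (lamP j) (rhoP j) (inv j).
Qed.
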